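(* Let $\varphi:\mathbb{D}\to\mathbb{C}$ be an analytic univalent function with positive real part in $\mathbb{D}$, with $\varphi(0)=1$, $\varphi'(0)>0$ and $\varphi''(0)\in\mathbb{R}$, and write $\varphi(z)=1+B_1z+B_2z^2+\cdots$. Suppose that $B_1>0$ and $B_1-B_1^2\le B_2\le 2B_1^2-B_1$. Then every $f\in\mathcal{K}(\varphi)$ satisfies $$|T_3(1)|\le 1+\frac12B_1^2+\frac1{36}\,(B_1^2+B_2)(2B_1^2-B_2),$$ where $T_3(1)$ is the Toeplitz determinant of $f$. The bound is sharp, i.e. for each such $\varphi$ there is a function $f\in\mathcal{K}(\varphi)$ for which equality holds.
   Context: $\mathbb{D}$ is the open unit disk in $\mathbb{C}$. $\mathcal{A}$ is the class of analytic functions $f:\mathbb{D}\to\mathbb{C}$ with Taylor series $f(z)=z+\sum_{n\ge2}a_nz^n$, and $\mathcal{S}\subset\mathcal{A}$ is the subclass of univalent (one-to-one) functions. For analytic functions $g,F$ on $\mathbb{D}$, $g$ is subordinate to $F$, written $g\prec F$, if there is an analytic $w:\mathbb{D}\to\mathbb{D}$ with $w(0)=0$ such that $g(z)=F(w(z))$ for all $z\in\mathbb{D}$. The class $\mathcal{K}(\varphi)$ is $$\mathcal{K}(\varphi):=\left\{f\in\mathcal{S}:\ 1+\frac{zf''(z)}{f'(z)}\prec\varphi(z)\right\}.$$ For $f(z)=z+\sum_{n\ge2}a_nz^n$ (so $a_1=1$), $T_q(n)$ denotes the determinant of the $q\times q$ symmetric Toeplitz matrix whose $(i,j)$ entry is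 $a_{n+|i-j|}$; in particular $$T_3(1)=\begin{vmatrix} 1 & a_2 & a_3 \\ a_2 & 1 & a_2 \\ a_3 & a_2 & 1 \end{vmatrix}.$$ *)

(* Defs.v *)
From Stdlib Require Import Reals Arith.
From Coquelicot Require Import Coquelicot.

Open Scope R_scope.

(* Functions on the unit disk are represented by total functions [C -> C];
   every notion below only depends on their values in the open disk. *)
Definition in_disk (z : C) : Prop := Cmod z < 1.

(* Complex analyticity: at each point of the disk the function is locally
   the sum of a convergent power series. *)
Definition analytic_on_disk (f : C -> C) : Prop :=
  forall z0 : C, in_disk z0 ->
  exists (a : nat -> C) (r : R), 0 < r /\
    forall z : C, in_disk z -> Cmod (z - z0) < r ->
      is_pseries (K := C_AbsRing) (V := C_NormedModule) a (z - z0)%C (f z).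

Definition univalent_on_disk (f : C -> C) : Prop :=
  forall z1 z2 : C, in_disk z1 -> in_disk z2 -> f z1 = f z2 -> z1 = z2.

Definition C_derive_n (f : C -> C) (n : nat) : C -> C := Nat.iter n C_derive f.

Definition taylor_coef (f : C -> C) (n : nat) : C :=
  (C_derive_n f n 0 / RtoC (INR (fact n)))%C.

Definition class_A (f : C -> C) : Prop :=
  analytic_on_disk f /\ taylor_coef f 0 = RtoC 0 /\ taylor_coef f 1 = RtoC 1.

Definition class_S (f : C -> C) : Prop := class_A f /\ univalent_on_disk f.

Definition subordinate (g F : C -> C) : Prop :=
  exists w : C -> C,
    analytic_on_disk w /\
    (forall z : C, in_disk z -> in_disk (w z)) /\
    w 0 = RtoC 0 /\
    (forall z : C, in_disk z -> g z = F (w z)).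

(* The quotient is harmless although [/ 0] is total: the derivative of a
   univalent analytic function has no zero in the disk. *)
Definition class_K (phi f : C -> C) : Prop :=
  class_S f /\
  subordinate (fun z => 1 + z * C_derive_n f 2 z / C_derive f z)%C phi.

(* Determinant of the matrix [M i j], [i, j < q], expanded along row 0. *)
Fixpoint det (q : nat) (M : nat -> nat -> C) : C :=
  match q with
  | O => RtoC 1
  | S p =>
      sum_n (G := C_AbelianMonoid)
        (fun j => ((- (1)) ^ j * M O j *
           det p (fun i k => M (S i) (if Nat.ltb k j then k else S k)))%C) p
  end.

(* Rows and columns are numbered from 0; the truncated sum
   [(i - j) + (j - i)] is [|i - j|]. *)
Definition toeplitz_det (q n : nat) (f : C -> C) : C :=
  det q (fun i j => taylor_coef f (n + ((i - j) + (j - i)))).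

(* Main.v *)
Require Import Defs.
From Stdlib Require Import Reals Arith Lra Lia Psatz ClassicalEpsilon.
From Coquelicot Require Import Coquelicot.

Open Scope R_scope.

(* If 1 + z f''/f' = phi o w with w(z) = c1 z + c2 z^2 + ..., then 2 a2 = B1 c1 and
   6 a3 = B1 c2 + (B2 + B1^2) c1^2, while T_3(1) = 1 - 2 a2^2 - a3 (a3 - 2 a2^2).  The
   Schwarz-Pick inequality |c2| <= 1 - |c1|^2 and the two hypotheses on B2 bound |a3| by
   (B1^2 + B2)/6 and |a3 - 2 a2^2| by (2 B1^2 - B2)/6.  Equality holds for w(z) = i z, i.e. for
   f' = exp F with z F' = phi(i z) - 1.  This f is univalent because on each circle the tangent
   direction of its image turns monotonically through exactly 2 pi (the lift of its argument is
   arg z + Im F), so the image lies strictly on one side of each of its tangents.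

   The complex analysis is derived from C^1 holomorphy: differentiating under the integral sign
   along a homotopy of circles gives Cauchy's formula and hence local power series, radial
   integration gives primitives, and the maximum principle holds because |k|^2 + eps |z|^2 has
   positive Laplacian. *)

(** * Derivatives and continuity of complex-valued functions *)

(** The determinant is the sum of 1, - 2 a2^2 and - a3 (a3 - 2 a2^2), estimated separately. Both a3
    and a3 - 2 a2^2 have the form (B1 c2 + m c1^2) / 6, with m = B2 + B1^2 and m = B2 - 2 B1^2
    respectively; the hypotheses on B2 say that m >= B1 in the first case and - m >= B1 in the
    second, so B1 (1 - |c1|^2) + |m| |c1|^2 is largest at |c1| = 1. Choosing c1 = i makes c1^2 = -1,
    and then all three terms are nonnegative reals, so that the triangle inequality loses nothing.
    Analyticity is given through local power series, an awkward form for products, quotients and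
    compositions. Having a continuous complex derivative is equivalent and is preserved by the
    ordinary rules of calculus. Hence both directions of the equivalence are proved, and each new
    function is shown analytic by exhibiting a continuous derivative. *)

Definition has_deriv {T : Type} (i : T -> C) (f : T -> C) (t : T) (d : C) : Prop :=
  forall eps : R, 0 < eps -> exists delta : R, 0 < delta /\
    forall s : T, Cmod (i s - i t) < delta ->
      Cmod (f s - f t - d * (i s - i t)) <= eps * Cmod (i s - i t).

(** The map [i] places the parameter in C, so one set of rules serves both complex derivatives ([i]
    the identity) and velocities of curves ([i] the inclusion of R), and the chain rule can mix the
    two. *)
Notation cderiv := (has_deriv (fun z : C => z)).
Notation rderiv := (has_deriv RtoC).

Definition cont {T : Type} (i : T -> C) (f : T -> C) (t : T) : Prop :=
  forall eps : R, 0 < eps -> exists delta : R, 0 < delta /\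
    forall s : T, Cmod (i s - i t) < delta -> Cmod (f s - f t) < eps.

Notation ccont := (cont (fun z : C => z)).
Notation rcont := (cont RtoC).

Lemma Cmod_sub_sym (a b : C) : Cmod (a - b) = Cmod (b - a).
Proof. rewrite <- (Cmod_opp (a - b)). f_equal. ring. Qed.

Lemma Cmod_sub_le (a b : C) : Cmod (a - b) <= Cmod a + Cmod b.
Proof. rewrite <- (Cmod_opp b). apply Cmod_triangle. Qed.

Lemma Cmod_sub_ge (a b : C) : Cmod a - Cmod b <= Cmod (a - b).
Proof.
  pose proof (Cmod_triangle (a - b) b). replace (a - b + b)%C with a in H by ring. lra.
Qed.

Lemma im_le_Cmod (c : C) : Rabs (Im c) <= Cmod c.
Proof. eapply Rle_trans; [apply Rmax_r | apply Rmax_Cmod]. Qed.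

Lemma Cmod_le_Re_Im (c : C) : Cmod c <= Rabs (Re c) + Rabs (Im c).
Proof.
  pose proof (Cmod2_alt c) as H. pose proof (Cmod_ge_0 c).
  pose proof (Rabs_pos (Re c)). pose proof (Rabs_pos (Im c)).
  apply Rsqr_incr_0_var; [|lra]. unfold Rsqr.
  rewrite <- (pow2_abs (Re c)), <- (pow2_abs (Im c)) in H. nra.
Qed.

Lemma Ceq (a b : C) : Re a = Re b -> Im a = Im b -> a = b.
Proof. destruct a, b; simpl; congruence. Qed.

Section Calculus.
Context {T : Type} (i : T -> C).

Lemma has_deriv_lip f t d : has_deriv i f t d ->
  exists delta, 0 < delta /\ forall s, Cmod (i s - i t) < delta ->
    Cmod (f s - f t) <= (Cmod d + 1) * Cmod (i s - i t).
Proof.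
  intros H. destruct (H 1 Rlt_0_1) as [e [He H1]].
  exists e; split; auto. intros s Hs. specialize (H1 s Hs).
  replace (f s - f t)%C with ((f s - f t - d * (i s - i t)) + d * (i s - i t))%C by ring.
  eapply Rle_trans; [apply Cmod_triangle|]. rewrite Cmod_mult. lra.
Qed.

Lemma has_deriv_cont f t d : has_deriv i f t d -> cont i f t.
Proof.
  intros H eps He. destruct (has_deriv_lip _ _ _ H) as [e [He1 H1]].
  pose proof (Cmod_ge_0 d) as Hd.
  exists (Rmin e (eps / (Cmod d + 1))). split.
  { apply Rmin_glb_lt; auto. apply Rdiv_lt_0_compat; lra. }
  intros s Hs. eapply Rle_lt_trans; [apply H1|].
  - eapply Rlt_le_trans; [apply Hs|apply Rmin_l].
  - assert (Hs2 : Cmod (i s - i t) < eps / (Cmod d + 1)).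
    { eapply Rlt_le_trans; [apply Hs|apply Rmin_r]. }
    apply Rmult_lt_compat_l with (r := Cmod d + 1) in Hs2; [|lra].
    replace ((Cmod d + 1) * (eps / (Cmod d + 1))) with eps in Hs2 by (field; lra). lra.
Qed.

(** Absorbs a fixed factor into the error, so that the rules below need not tune their
    tolerances. *)
Lemma has_deriv_scaled f t d K : 0 < K ->
  (forall eps, 0 < eps -> exists delta, 0 < delta /\ forall s, Cmod (i s - i t) < delta ->
      Cmod (f s - f t - d * (i s - i t)) <= K * eps * Cmod (i s - i t)) ->
  has_deriv i f t d.
Proof.
  intros HK H eps He. destruct (H (eps / K)) as [e [He1 H1]].
  { apply Rdiv_lt_0_compat; lra. }
  exists e; split; auto. intros s Hs. specialize (H1 s Hs).
  replace (K * (eps / K)) with eps in H1 by (field; lra). exact H1.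
Qed.

Lemma has_deriv_const c t : has_deriv i (fun _ => c) t 0.
Proof.
  intros eps He. exists 1; split; [lra|]. intros s _.
  replace (c - c - 0 * (i s - i t))%C with (RtoC 0) by ring. rewrite Cmod_0.
  apply Rmult_le_pos; [lra|apply Cmod_ge_0].
Qed.

Lemma has_deriv_id t : has_deriv i i t 1.
Proof.
  intros eps He. exists 1; split; [lra|]. intros s _.
  replace (i s - i t - 1 * (i s - i t))%C with (RtoC 0) by ring. rewrite Cmod_0.
  apply Rmult_le_pos; [lra|apply Cmod_ge_0].
Qed.

Lemma has_deriv_plus f g t df dg : has_deriv i f t df -> has_deriv i g t dg ->
  has_deriv i (fun s => f s + g s)%C t (df + dg).
Proof.
  intros Hf Hg. apply (has_deriv_scaled _ _ _ 2); [lra|]. intros eps He.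
  destruct (Hf eps He) as [e1 [H1 F]]. destruct (Hg eps He) as [e2 [H2 G]].
  exists (Rmin e1 e2). split; [apply Rmin_glb_lt; auto|]. intros s Hs.
  specialize (F s (Rlt_le_trans _ _ _ Hs (Rmin_l _ _))).
  specialize (G s (Rlt_le_trans _ _ _ Hs (Rmin_r _ _))).
  replace (f s + g s - (f t + g t) - (df + dg) * (i s - i t))%C with
    ((f s - f t - df * (i s - i t)) + (g s - g t - dg * (i s - i t)))%C by ring.
  eapply Rle_trans; [apply Cmod_triangle|]. lra.
Qed.

Lemma has_deriv_mult f g t df dg : has_deriv i f t df -> has_deriv i g t dg ->
  has_deriv i (fun s => f s * g s)%C t (df * g t + f t * dg).
Proof.
  intros Hf Hg.
  destruct (has_deriv_lip _ _ _ Hf) as [l1 [L1 LF]].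
  pose proof (has_deriv_cont _ _ _ Hg) as CG.
  pose proof (Cmod_ge_0 df) as P1. pose proof (Cmod_ge_0 (f t)) as P2.
  pose proof (Cmod_ge_0 (g t)) as P3.
  apply (has_deriv_scaled _ _ _ (Cmod (g t) + Cmod (f t) + (Cmod df + 1))); [lra|].
  intros eps He.
  destruct (Hf eps He) as [e1 [H1 F]]. destruct (Hg eps He) as [e2 [H2 G]].
  destruct (CG eps He) as [e3 [H3 G3]].
  exists (Rmin (Rmin e1 e2) (Rmin e3 l1)). split; [repeat apply Rmin_glb_lt; auto|]. intros s Hs.
  pose proof (Rmin_l (Rmin e1 e2) (Rmin e3 l1)). pose proof (Rmin_r (Rmin e1 e2) (Rmin e3 l1)).
  pose proof (Rmin_l e1 e2). pose proof (Rmin_r e1 e2).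
  pose proof (Rmin_l e3 l1). pose proof (Rmin_r e3 l1).
  specialize (F s ltac:(lra)). specialize (G s ltac:(lra)).
  specialize (G3 s ltac:(lra)). specialize (LF s ltac:(lra)).
  replace (f s * g s - f t * g t - (df * g t + f t * dg) * (i s - i t))%C with
    ((f s - f t - df * (i s - i t)) * g t + f t * (g s - g t - dg * (i s - i t)) +
      (f s - f t) * (g s - g t))%C by ring.
  eapply Rle_trans; [apply Cmod_triangle|].
  eapply Rle_trans; [apply Rplus_le_compat_r, Cmod_triangle|]. rewrite !Cmod_mult.
  set (D := Cmod (i s - i t)) in *. pose proof (Cmod_ge_0 (i s - i t)) as PD. fold D in PD.
  assert (Cmod (f s - f t - df * (i s - i t)) * Cmod (g t) <= eps * D * Cmod (g t))
    by (apply Rmult_le_compat_r; auto).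
  assert (Cmod (f t) * Cmod (g s - g t - dg * (i s - i t)) <= Cmod (f t) * (eps * D))
    by (apply Rmult_le_compat_l; auto).
  assert (Cmod (f s - f t) * Cmod (g s - g t) <= (Cmod df + 1) * D * eps).
  { apply Rmult_le_compat; auto using Cmod_ge_0; lra. }
  nra.
Qed.

Lemma has_deriv_comp f g t df dg : cderiv f (g t) df -> has_deriv i g t dg ->
  has_deriv i (fun s => f (g s)) t (df * dg).
Proof.
  intros Hf Hg.
  destruct (has_deriv_lip _ _ _ Hg) as [l1 [L1 LG]].
  pose proof (has_deriv_cont _ _ _ Hg) as CG.
  pose proof (Cmod_ge_0 dg) as P1. pose proof (Cmod_ge_0 df) as P2.
  apply (has_deriv_scaled _ _ _ (Cmod dg + 1 + Cmod df)); [lra|].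
  intros eps He.
  destruct (Hf eps He) as [e1 [H1 F]]. destruct (Hg eps He) as [e2 [H2 G]].
  destruct (CG e1 H1) as [e3 [H3 G3]].
  exists (Rmin e2 (Rmin e3 l1)). split; [repeat apply Rmin_glb_lt; auto|]. intros s Hs.
  pose proof (Rmin_l e2 (Rmin e3 l1)). pose proof (Rmin_r e2 (Rmin e3 l1)).
  pose proof (Rmin_l e3 l1). pose proof (Rmin_r e3 l1).
  specialize (G s ltac:(lra)).
  specialize (G3 s ltac:(lra)). specialize (LG s ltac:(lra)). specialize (F (g s) G3).
  replace (f (g s) - f (g t) - df * dg * (i s - i t))%C with
    ((f (g s) - f (g t) - df * (g s - g t)) + df * (g s - g t - dg * (i s - i t)))%C by ring.
  eapply Rle_trans; [apply Cmod_triangle|]. rewrite Cmod_mult.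
  set (D := Cmod (i s - i t)) in *. pose proof (Cmod_ge_0 (i s - i t)) as PD. fold D in PD.
  assert (Cmod df * Cmod (g s - g t - dg * (i s - i t)) <= Cmod df * (eps * D))
    by (apply Rmult_le_compat_l; auto).
  assert (eps * Cmod (g s - g t) <= eps * ((Cmod dg + 1) * D)) by (apply Rmult_le_compat_l; lra).
  nra.
Qed.

Lemma has_deriv_eq f t d d' : has_deriv i f t d -> d = d' -> has_deriv i f t d'.
Proof. intros; subst; auto. Qed.

Lemma has_deriv_ext_loc f g t d e : 0 < e ->
  (forall s, Cmod (i s - i t) < e -> f s = g s) -> has_deriv i f t d -> has_deriv i g t d.
Proof.
  intros He E H eps Heps. destruct (H eps Heps) as [e1 [H1 F]].
  exists (Rmin e e1); split; [apply Rmin_glb_lt; auto|]. intros s Hs.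
  rewrite <- !E.
  - apply F. eapply Rlt_le_trans; [apply Hs|apply Rmin_r].
  - replace (i t - i t)%C with (RtoC 0) by ring. rewrite Cmod_0; auto.
  - eapply Rlt_le_trans; [apply Hs|apply Rmin_l].
Qed.

Lemma cont_const c t : cont i (fun _ => c) t.
Proof. apply (has_deriv_cont _ _ _ (has_deriv_const c t)). Qed.

Lemma cont_id t : cont i i t.
Proof. apply (has_deriv_cont _ _ _ (has_deriv_id t)). Qed.

Lemma cont_comp f g t : ccont f (g t) -> cont i g t -> cont i (fun s => f (g s)) t.
Proof.
  intros Hf Hg eps He. destruct (Hf eps He) as [e1 [H1 F]].
  destruct (Hg e1 H1) as [e2 [H2 G]]. exists e2; split; auto.
Qed.

Lemma cont_plus f g t : cont i f t -> cont i g t -> cont i (fun s => f s + g s)%C t.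
Proof.
  intros Hf Hg eps He.
  destruct (Hf (eps/2) ltac:(lra)) as [e1 [H1 F]]. destruct (Hg (eps/2) ltac:(lra)) as [e2 [H2 G]].
  exists (Rmin e1 e2). split; [apply Rmin_glb_lt; auto|]. intros s Hs.
  specialize (F s (Rlt_le_trans _ _ _ Hs (Rmin_l _ _))).
  specialize (G s (Rlt_le_trans _ _ _ Hs (Rmin_r _ _))).
  replace (f s + g s - (f t + g t))%C with ((f s - f t) + (g s - g t))%C by ring.
  eapply Rle_lt_trans; [apply Cmod_triangle|]. lra.
Qed.

Lemma cont_mult f g t : cont i f t -> cont i g t -> cont i (fun s => f s * g s)%C t.
Proof.
  intros Hf Hg eps He.
  pose proof (Cmod_ge_0 (f t)) as P2. pose proof (Cmod_ge_0 (g t)) as P3.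
  set (K := Cmod (f t) + Cmod (g t) + 1).
  assert (HK : 0 < K) by (unfold K; lra).
  set (m := Rmin 1 (eps / (2 * K))).
  assert (Hm : 0 < m) by (apply Rmin_glb_lt; [lra|apply Rdiv_lt_0_compat; lra]).
  assert (Hm1 : m <= 1) by apply Rmin_l.
  assert (Hm2 : K * m <= eps / 2).
  { replace (eps / 2) with (K * (eps / (2 * K))) by (field; lra).
    apply Rmult_le_compat_l; [lra|apply Rmin_r]. }
  destruct (Hf m Hm) as [e1 [H1 F]]. destruct (Hg m Hm) as [e2 [H2 G]].
  exists (Rmin e1 e2). split; [apply Rmin_glb_lt; auto|]. intros s Hs.
  specialize (F s (Rlt_le_trans _ _ _ Hs (Rmin_l _ _))).
  specialize (G s (Rlt_le_trans _ _ _ Hs (Rmin_r _ _))).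
  replace (f s * g s - f t * g t)%C with
    ((f s - f t) * g t + f t * (g s - g t) + (f s - f t) * (g s - g t))%C by ring.
  eapply Rle_lt_trans; [apply Cmod_triangle|].
  eapply Rle_lt_trans; [apply Rplus_le_compat_r, Cmod_triangle|]. rewrite !Cmod_mult.
  assert (Cmod (f s - f t) * Cmod (g t) <= m * Cmod (g t)) by (apply Rmult_le_compat_r; lra).
  assert (Cmod (f t) * Cmod (g s - g t) <= Cmod (f t) * m) by (apply Rmult_le_compat_l; lra).
  assert (Cmod (f s - f t) * Cmod (g s - g t) <= m * 1)
    by (apply Rmult_le_compat; auto using Cmod_ge_0; lra).
  unfold K in Hm2. nra.
Qed.

Lemma cont_ext_loc f g t e : 0 < e ->
  (forall s, Cmod (i s - i t) < e -> f s = g s) -> cont i f t -> cont i g t.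
Proof.
  intros He E H eps Heps. destruct (H eps Heps) as [e1 [H1 F]].
  exists (Rmin e e1); split; [apply Rmin_glb_lt; auto|]. intros s Hs.
  rewrite <- !E.
  - apply F. eapply Rlt_le_trans; [apply Hs|apply Rmin_r].
  - replace (i t - i t)%C with (RtoC 0) by ring. rewrite Cmod_0; auto.
  - eapply Rlt_le_trans; [apply Hs|apply Rmin_l].
Qed.

End Calculus.

Lemma cderiv_inv (z : C) : z <> 0 -> cderiv Cinv z (- (/ (z * z)))%C.
Proof.
  intros Hz. pose proof (proj1 (Cmod_gt_0 z) Hz) as P. set (m := Cmod z) in *.
  assert (P3 : 0 < m * m * m) by (repeat apply Rmult_lt_0_compat; auto).
  apply (has_deriv_scaled _ _ _ _ (2 / (m * m * m))).
  { apply Rdiv_lt_0_compat; lra. }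
  (* Within m / 2 of z one has |w| >= m / 2, so the exact remainder (w - z)^2 / (w z^2) is at most 2
     |w - z|^2 / m^3. *)
  intros eps He. exists (Rmin (m / 2) eps). split; [apply Rmin_glb_lt; lra|].
  intros w Hw. pose proof (Rmin_l (m/2) eps). pose proof (Rmin_r (m/2) eps).
  assert (Q : m / 2 <= Cmod w).
  { pose proof (Cmod_sub_ge z w). rewrite Cmod_sub_sym in Hw. fold m in H1. lra. }
  assert (Hw0 : w <> 0) by (apply Cmod_gt_0; lra).
  replace (/ w - / z - - / (z * z) * (w - z))%C with ((w - z) * (w - z) * / (w * (z * z)))%C
    by (field; auto).
  rewrite !Cmod_mult, Cmod_inv, !Cmod_mult; [|repeat apply Cmult_neq_0; auto]. fold m.
  set (D := Cmod (w - z)) in *. assert (0 <= D) by apply Cmod_ge_0.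
  assert (/ (Cmod w * (m * m)) <= 2 / (m * m * m)).
  { replace (2 / (m * m * m)) with (/ (m / 2 * (m * m))) by (field; lra).
    apply Rinv_le_contravar; [nra|]. apply Rmult_le_compat_r; nra. }
  assert (0 <= / (Cmod w * (m * m))) by (left; apply Rinv_0_lt_compat; nra).
  assert (D * D <= eps * D) by (apply Rmult_le_compat_r; lra).
  assert (D * D * / (Cmod w * (m * m)) <= (eps * D) * (2 / (m * m * m))).
  { apply Rmult_le_compat; auto. nra. }
  lra.
Qed.

Lemma has_deriv_inv {T} (i : T -> C) (g : T -> C) t dg : g t <> RtoC 0 -> has_deriv i g t dg ->
  has_deriv i (fun s => / g s)%C t (- (/ (g t * g t)) * dg).
Proof. intros. apply (has_deriv_comp i Cinv); auto. apply cderiv_inv; auto. Qed.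

Lemma cont_inv {T} (i : T -> C) (g : T -> C) t : g t <> RtoC 0 -> cont i g t -> cont i (fun s => / g s)%C t.
Proof.
  intros. apply (cont_comp i Cinv); auto.
  eapply has_deriv_cont, cderiv_inv; auto.
Qed.

Lemma cont_RtoC_Re {T} (i : T -> C) g t : cont i g t -> cont i (fun s => RtoC (Re (g s))) t.
Proof.
  intros H eps He. destruct (H eps He) as [e [H1 F]]. exists e; split; auto.
  intros s Hs. rewrite <- RtoC_minus, Cmod_R. eapply Rle_lt_trans; [|apply (F s Hs)].
  replace (Re (g s) - Re (g t)) with (Re (g s - g t)) by reflexivity. apply re_le_Cmod.
Qed.

Lemma cont_RtoC_Im {T} (i : T -> C) g t : cont i g t -> cont i (fun s => RtoC (Im (g s))) t.
Proof.
  intros H eps He. destruct (H eps He) as [e [H1 F]]. exists e; split; auto.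
  intros s Hs. rewrite <- RtoC_minus, Cmod_R. eapply Rle_lt_trans; [|apply (F s Hs)].
  replace (Im (g s) - Im (g t)) with (Im (g s - g t)) by reflexivity. apply im_le_Cmod.
Qed.

(** The bridge to [C_derive], in which the classes of the statement are phrased. *)
Lemma cderiv_is_derive (f : C -> C) (z d : C) :
  cderiv f z d <-> is_derive (K := C_AbsRing) (V := C_NormedModule) f z d.
Proof.
  split.
  - intros H. split; [apply is_linear_scal_l|]. intros y Hy eps.
    assert (y = z) as ->.
    { symmetry. apply (is_filter_lim_locally_unique (V := AbsRing_NormedModule C_AbsRing) z y Hy). }
    destruct (H eps (cond_pos eps)) as [e [He F]].
    exists (mkposreal e He). intros w Hw. specialize (F w Hw).
    change (Cmod (f w - f z - (w - z) * d) <= eps * Cmod (w - z)).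
    rewrite (Cmult_comm (w - z) d). exact F.
  - intros [_ H] eps He. specialize (H z (fun P HP => HP) (mkposreal eps He)).
    destruct H as [e H]. exists e; split; [apply cond_pos|]. intros w Hw.
    specialize (H w Hw).
    change (Cmod (f w - f z - (w - z) * d) <= eps * Cmod (w - z)) in H.
    rewrite (Cmult_comm (w - z) d) in H. exact H.
Qed.

Lemma cderiv_C_derive (f : C -> C) (z d : C) : cderiv f z d -> C_derive f z = d.
Proof. intros H. apply is_C_derive_unique, cderiv_is_derive, H. Qed.

Lemma cderiv_unique (f : C -> C) (z d d' : C) : cderiv f z d -> cderiv f z d' -> d = d'.
Proof. intros H H'. rewrite <- (cderiv_C_derive _ _ _ H). apply cderiv_C_derive, H'. Qed.

(** * Complex exponential and integrals of complex-valued functions *)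

Lemma is_derive_eps (f : R -> R) (x l : R) : is_derive f x l <->
  forall eps, 0 < eps -> exists delta, 0 < delta /\ forall y, Rabs (y - x) < delta ->
    Rabs (f y - f x - l * (y - x)) <= eps * Rabs (y - x).
Proof.
  split.
  - intros [_ H] eps He. specialize (H x (fun P HP => HP) (mkposreal eps He)).
    destruct H as [e H]. exists e; split; [apply cond_pos|]. intros w Hw.
    specialize (H w Hw).
    change (Rabs (f w - f x - (w - x) * l) <= eps * Rabs (w - x)) in H.
    rewrite (Rmult_comm (w - x) l) in H. exact H.
  - intros H. split; [apply is_linear_scal_l|]. intros y Hy eps.
    assert (y = x) as ->.
    { symmetry. apply (is_filter_lim_locally_unique (V := R_NormedModule) x y Hy). }
    destruct (H eps (cond_pos eps)) as [e [He F]].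
    exists (mkposreal e He). intros w Hw. specialize (F w Hw).
    change (Rabs (f w - f x - (w - x) * l) <= eps * Rabs (w - x)).
    rewrite (Rmult_comm (w - x) l). exact F.
Qed.

Lemma rderiv_Re (g : R -> C) t v : rderiv g t v -> is_derive (fun s => Re (g s)) t (Re v).
Proof.
  intros H. apply is_derive_eps. intros eps He. destruct (H eps He) as [e [H1 F]].
  exists e; split; auto. intros s Hs.
  specialize (F s). rewrite <- RtoC_minus, Cmod_R in F. specialize (F Hs).
  eapply Rle_trans; [|apply F].
  replace (Re (g s) - Re (g t) - Re v * (s - t)) with (Re (g s - g t - v * RtoC (s - t))%C).
  - apply re_le_Cmod.
  - unfold Re, Im; simpl; ring.
Qed.

Lemma rderiv_Im (g : R -> C) t v : rderiv g t v -> is_derive (fun s => Im (g s)) t (Im v).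
Proof.
  intros H. apply is_derive_eps. intros eps He. destruct (H eps He) as [e [H1 F]].
  exists e; split; auto. intros s Hs.
  specialize (F s). rewrite <- RtoC_minus, Cmod_R in F. specialize (F Hs).
  eapply Rle_trans; [|apply F].
  replace (Im (g s) - Im (g t) - Im v * (s - t)) with (Im (g s - g t - v * RtoC (s - t))%C).
  - apply im_le_Cmod.
  - unfold Re, Im; simpl; ring.
Qed.

Lemma rderiv_pair (u v : R -> R) t a b : is_derive u t a -> is_derive v t b ->
  rderiv (fun s => (u s, v s)) t (a, b).
Proof.
  intros Hu Hv. apply (has_deriv_scaled _ _ _ _ 2); [lra|]. intros eps He.
  destruct (proj1 (is_derive_eps _ _ _) Hu eps He) as [e1 [H1 F]].
  destruct (proj1 (is_derive_eps _ _ _) Hv eps He) as [e2 [H2 G]].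
  exists (Rmin e1 e2). split; [apply Rmin_glb_lt; auto|]. intros s Hs.
  rewrite <- RtoC_minus, Cmod_R in *.
  specialize (F s (Rlt_le_trans _ _ _ Hs (Rmin_l _ _))).
  specialize (G s (Rlt_le_trans _ _ _ Hs (Rmin_r _ _))).
  eapply Rle_trans; [apply Cmod_le_Re_Im|]. simpl.
  replace (u s + - u t + - (a * (s - t) - b * 0)) with (u s - u t - a * (s - t)) by ring.
  replace (v s + - v t + - (a * 0 + b * (s - t))) with (v s - v t - b * (s - t)) by ring.
  lra.
Qed.

Definition Cexp (z : C) : C := (exp (Re z) * cos (Im z), exp (Re z) * sin (Im z)).

Lemma Cexp_plus (z w : C) : Cexp (z + w) = (Cexp z * Cexp w)%C.
Proof.
  apply Ceq; unfold Cexp, Re, Im; simpl; rewrite exp_plus, ?cos_plus, ?sin_plus; ring.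
Qed.

Lemma Cexp_0 : Cexp 0 = 1.
Proof. apply Ceq; simpl; rewrite exp_0, ?cos_0, ?sin_0; ring. Qed.

Lemma Cexp_neq_0 (z : C) : Cexp z <> 0.
Proof.
  intros H. assert (E : (Cexp z * Cexp (- z))%C = 1).
  { rewrite <- Cexp_plus. replace (z + - z)%C with (RtoC 0) by ring. apply Cexp_0. }
  rewrite H in E. apply C1_nz. rewrite <- E. ring.
Qed.

Lemma Cmod_Cexp_Im (x : R) : Cmod (Cexp (0, x)) = 1.
Proof.
  apply Rsqr_inj; [apply Cmod_ge_0|lra|]. unfold Rsqr.
  replace (Cmod (Cexp (0, x)) * Cmod (Cexp (0, x))) with (Cmod (Cexp (0, x)) ^ 2) by ring.
  rewrite Cmod2_alt. simpl. rewrite exp_0. pose proof (sin2_cos2 x). unfold Rsqr in H. nra.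
Qed.

Lemma cderiv_Cexp_0 : cderiv Cexp 0 1.
Proof.
  (* 9 = 1 + 3 + 3 + 2 collects the bounds of the four pieces into which the real and imaginary
     remainders are split. *)
  apply (has_deriv_scaled _ _ _ _ 9); [lra|]. intros eps He.
  assert (De : is_derive exp 0 1) by (pose proof (is_derive_exp 0) as H; rewrite exp_0 in H; exact H).
  assert (Dc : is_derive cos 0 0).
  { apply is_derive_Reals. pose proof (derivable_pt_lim_cos 0) as H. rewrite sin_0, Ropp_0 in H. exact H. }
  assert (Ds : is_derive sin 0 1).
  { apply is_derive_Reals. pose proof (derivable_pt_lim_sin 0) as H. rewrite cos_0 in H. exact H. }
  (* The tolerance is capped at 1 so that the same estimate also yields |exp x - 1| <= 2 |z|. *)
  destruct (proj1 (is_derive_eps exp 0 1) De (Rmin eps 1)) as [e1 [H1 F]]; [apply Rmin_glb_lt; lra|].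
  destruct (proj1 (is_derive_eps cos 0 0) Dc eps He) as [e2 [H2 G]].
  destruct (proj1 (is_derive_eps sin 0 1) Ds eps He) as [e3 [H3 K]].
  exists (Rmin (Rmin e1 e2) (Rmin e3 (Rmin 1 eps))). split; [repeat apply Rmin_glb_lt; lra|].
  intros z. replace (z - 0)%C with z by ring. intros Hz. rewrite Cexp_0.
  pose proof (Rmin_l (Rmin e1 e2) (Rmin e3 (Rmin 1 eps))).
  pose proof (Rmin_r (Rmin e1 e2) (Rmin e3 (Rmin 1 eps))).
  pose proof (Rmin_l e1 e2). pose proof (Rmin_r e1 e2).
  pose proof (Rmin_l e3 (Rmin 1 eps)). pose proof (Rmin_r e3 (Rmin 1 eps)).
  pose proof (Rmin_l 1 eps). pose proof (Rmin_r 1 eps).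
  pose proof (Rmin_l eps 1). pose proof (Rmin_r eps 1).
  pose proof (re_le_Cmod z) as Bx. pose proof (im_le_Cmod z) as By.
  destruct z as [x y]. simpl in Bx, By. set (D := Cmod (x, y)) in *.
  specialize (F x). specialize (G y). specialize (K y).
  rewrite Rminus_0_r in F, G, K. rewrite exp_0 in F. rewrite cos_0 in G. rewrite sin_0 in K.
  specialize (F ltac:(lra)). specialize (G ltac:(lra)). specialize (K ltac:(lra)).
  pose proof (Rabs_pos x). pose proof (Rabs_pos y).
  assert (F1 : Rabs (exp x - 1 - 1 * x) <= eps * D).
  { eapply Rle_trans; [apply F|]. apply Rmult_le_compat; try lra. apply Rmin_glb; lra. }
  assert (F2 : Rabs (exp x - 1) <= 2 * D).
  { replace (exp x - 1) with ((exp x - 1 - 1 * x) + x) by ring.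
    eapply Rle_trans; [apply Rabs_triang|].
    assert (Rmin eps 1 * Rabs x <= 1 * D) by (apply Rmult_le_compat; try lra; apply Rmin_glb; lra).
    lra. }
  assert (F3 : Rabs (exp x) <= 3).
  { replace (exp x) with ((exp x - 1) + 1) by ring. eapply Rle_trans; [apply Rabs_triang|].
    rewrite Rabs_R1. lra. }
  assert (G1 : Rabs (cos y - 1) <= eps * D).
  { replace (cos y - 1) with (cos y - 1 - 0 * y) by ring. eapply Rle_trans; [apply G|].
    apply Rmult_le_compat_l; lra. }
  assert (K1 : Rabs (sin y - y) <= eps * D).
  { replace (sin y - y) with (sin y - 0 - 1 * y) by ring. eapply Rle_trans; [apply K|].
    apply Rmult_le_compat_l; lra. }
  eapply Rle_trans; [apply Cmod_le_Re_Im|]. simpl.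
  replace (exp x * cos y + - (1) + - (1 * x - 0 * y)) with
    ((exp x - 1 - 1 * x) + exp x * (cos y - 1)) by ring.
  replace (exp x * sin y + - 0 + - (1 * y + 0 * x)) with
    (exp x * (sin y - y) + (exp x - 1) * y) by ring.
  assert (Rabs (exp x * (cos y - 1)) <= 3 * (eps * D)).
  { rewrite Rabs_mult. apply Rmult_le_compat; auto using Rabs_pos. }
  assert (Rabs (exp x * (sin y - y)) <= 3 * (eps * D)).
  { rewrite Rabs_mult. apply Rmult_le_compat; auto using Rabs_pos. }
  assert (Rabs ((exp x - 1) * y) <= 2 * D * eps).
  { rewrite Rabs_mult. apply Rmult_le_compat; auto using Rabs_pos; lra. }
  eapply Rle_trans; [apply Rplus_le_compat; apply Rabs_triang|]. lra.
Qed.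

Lemma cderiv_Cexp (z : C) : cderiv Cexp z (Cexp z).
Proof.
  apply (has_deriv_ext_loc _ (fun w => Cexp z * Cexp (w + - z))%C _ _ _ 1); [lra| |].
  - intros w _. rewrite <- Cexp_plus. f_equal. ring.
  - eapply has_deriv_eq.
    + apply has_deriv_mult; [apply has_deriv_const|].
      apply (has_deriv_comp _ Cexp).
      * replace (z + - z)%C with (RtoC 0) by ring. apply cderiv_Cexp_0.
      * apply has_deriv_plus; [apply has_deriv_id | apply has_deriv_const].
    + cbv beta; ring.
Qed.

Definition cint (g : R -> C) (a b : R) : C :=
  (RInt (fun t => Re (g t)) a b, RInt (fun t => Im (g t)) a b).

Lemma rcont_Re (g : R -> C) t : rcont g t -> continuous (fun s => Re (g s)) t.
Proof.
  intros H. apply continuity_pt_filterlim. intros eps He. destruct (H eps He) as [e [H1 F]].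
  exists e; split; auto. intros s [_ Hs]. simpl in *. unfold R_dist in *.
  replace (Re (g s) - Re (g t)) with (Re (g s - g t)%C) by reflexivity.
  eapply Rle_lt_trans; [apply re_le_Cmod|]. apply F. rewrite <- RtoC_minus, Cmod_R. exact Hs.
Qed.

Lemma rcont_Im (g : R -> C) t : rcont g t -> continuous (fun s => Im (g s)) t.
Proof.
  intros H. apply continuity_pt_filterlim. intros eps He. destruct (H eps He) as [e [H1 F]].
  exists e; split; auto. intros s [_ Hs]. simpl in *. unfold R_dist in *.
  replace (Im (g s) - Im (g t)) with (Im (g s - g t)%C) by reflexivity.
  eapply Rle_lt_trans; [apply im_le_Cmod|]. apply F. rewrite <- RtoC_minus, Cmod_R. exact Hs.
Qed.

Section Cint.
Variables a b : R.
Hypothesis Hab : a <= b.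

Lemma ex_RInt_Re (g : R -> C) : (forall t, a <= t <= b -> rcont g t) ->
  ex_RInt (fun t => Re (g t)) a b.
Proof.
  intros H. apply (ex_RInt_continuous (V := R_CompleteNormedModule)). intros t Ht. apply rcont_Re, H.
  rewrite Rmin_left, Rmax_right in Ht; auto.
Qed.

Lemma ex_RInt_Im (g : R -> C) : (forall t, a <= t <= b -> rcont g t) ->
  ex_RInt (fun t => Im (g t)) a b.
Proof.
  intros H. apply (ex_RInt_continuous (V := R_CompleteNormedModule)). intros t Ht. apply rcont_Im, H.
  rewrite Rmin_left, Rmax_right in Ht; auto.
Qed.

Lemma cint_ext (g h : R -> C) : (forall t, a <= t <= b -> g t = h t) -> cint g a b = cint h a b.
Proof.
  intros H. unfold cint. f_equal; apply RInt_ext; intros t Ht; rewrite H; auto;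
  rewrite Rmin_left, Rmax_right in Ht; lra.
Qed.

Lemma cint_plus (g h : R -> C) : (forall t, a <= t <= b -> rcont g t) ->
  (forall t, a <= t <= b -> rcont h t) ->
  cint (fun t => g t + h t)%C a b = (cint g a b + cint h a b)%C.
Proof.
  intros Hg Hh. unfold cint. apply Ceq; simpl.
  - apply (RInt_plus (fun t => Re (g t)) (fun t => Re (h t))); apply ex_RInt_Re; auto.
  - apply (RInt_plus (fun t => Im (g t)) (fun t => Im (h t))); apply ex_RInt_Im; auto.
Qed.

Lemma cint_scal (c : C) (g : R -> C) : (forall t, a <= t <= b -> rcont g t) ->
  cint (fun t => c * g t)%C a b = (c * cint g a b)%C.
Proof.
  intros Hg. pose proof (ex_RInt_Re g Hg) as R1. pose proof (ex_RInt_Im g Hg) as R2.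
  apply Ceq.
  - change (RInt (fun t => Re c * Re (g t) - Im c * Im (g t)) a b =
      Re c * RInt (fun t => Re (g t)) a b - Im c * RInt (fun t => Im (g t)) a b).
    apply is_RInt_unique. apply (is_RInt_minus (V := R_NormedModule)
      (fun t => scal (Re c) (Re (g t))) (fun t => scal (Im c) (Im (g t))));
    apply (is_RInt_scal (V := R_NormedModule)), (RInt_correct (V := R_CompleteNormedModule)); auto.
  - change (RInt (fun t => Re c * Im (g t) + Im c * Re (g t)) a b =
      Re c * RInt (fun t => Im (g t)) a b + Im c * RInt (fun t => Re (g t)) a b).
    apply is_RInt_unique. apply (is_RInt_plus (V := R_NormedModule)
      (fun t => scal (Re c) (Im (g t))) (fun t => scal (Im c) (Re (g t))));
    apply (is_RInt_scal (V := R_NormedModule)), (RInt_correct (V := R_CompleteNormedModule)); auto.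
Qed.

Lemma cint_const (c : C) : cint (fun _ => c) a b = (c * RtoC (b - a))%C.
Proof.
  unfold cint. rewrite !RInt_const. apply Ceq; unfold Re, Im; simpl; unfold scal; simpl; unfold mult; simpl; ring.
Qed.

(** The factor 2 comes from treating real and imaginary parts separately; it is harmless, as the
    bound only serves to show that a remainder tends to 0. *)
Lemma cint_bound (g : R -> C) M : (forall t, a <= t <= b -> rcont g t) ->
  (forall t, a <= t <= b -> Cmod (g t) <= M) -> Cmod (cint g a b) <= 2 * (M * (b - a)).
Proof.
  intros Hg HM.
  eapply Rle_trans; [apply Cmod_le_Re_Im|]. simpl.
  assert (Rabs (RInt (fun t => Re (g t)) a b) <= (b - a) * M).
  { apply abs_RInt_le_const; auto using ex_RInt_Re.
    intros t Ht. eapply Rle_trans; [apply re_le_Cmod|apply HM; lra]. }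
  assert (Rabs (RInt (fun t => Im (g t)) a b) <= (b - a) * M).
  { apply abs_RInt_le_const; auto using ex_RInt_Im.
    intros t Ht. eapply Rle_trans; [apply im_le_Cmod|apply HM; lra]. }
  lra.
Qed.

Lemma cint_FTC (g g' : R -> C) : (forall t, a <= t <= b -> rderiv g t (g' t)) ->
  (forall t, a <= t <= b -> rcont g' t) -> cint g' a b = (g b - g a)%C.
Proof.
  intros Hd Hc. unfold cint. apply Ceq; simpl.
  - apply is_RInt_unique. apply (is_RInt_derive (fun t => Re (g t)) (fun t => Re (g' t)) a b);
    intros t Ht; rewrite Rmin_left, Rmax_right in Ht; auto.
    + apply rderiv_Re; auto.
    + apply rcont_Re; auto.
  - apply is_RInt_unique. apply (is_RInt_derive (fun t => Im (g t)) (fun t => Im (g' t)) a b);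
    intros t Ht; rewrite Rmin_left, Rmax_right in Ht; auto.
    + apply rderiv_Im; auto.
    + apply rcont_Im; auto.
Qed.

(** Differentiation under the integral sign. Joint continuity of [G'] is expressed by reading (s, t)
    as the complex number s + i t, which makes the rules for [ccont] available. The margin [e]
    around [a, b] is there because continuity of the partial derivative at an endpoint involves
    values of t on both sides of it. *)
Lemma cint_param (G G' : R -> R -> C) (x e : R) : 0 < e ->
  (forall s t, Rabs (s - x) < e -> a - e < t < b + e -> rderiv (fun s => G s t) s (G' s t)) ->
  (forall t, a <= t <= b -> ccont (fun p => G' (Re p) (Im p)) (x, t)) ->
  (forall s t, Rabs (s - x) < e -> a <= t <= b -> rcont (G s) t) ->
  rderiv (fun s => cint (G s) a b) x (cint (G' x) a b).
Proof.
  intros He HG HC HS.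
  assert (Hl : locally x (fun s => Rabs (s - x) < e)).
  { exists (mkposreal e He). intros s Hs. exact Hs. }
  assert (Hc2 : forall t, a <= t <= b -> forall eps : posreal, exists delta : posreal,
     forall u v, Rabs (u - x) < delta -> Rabs (v - t) < delta ->
       Rabs (u - x) < e /\ a - e < v < b + e /\ Cmod (G' u v - G' x t) < eps).
  { intros t Ht eps. destruct (HC t Ht eps (cond_pos eps)) as [d [Hd F]].
    assert (0 < Rmin (d / 2) e) by (apply Rmin_glb_lt; lra).
    exists (mkposreal _ H). simpl. intros u v Hu Hv.
    pose proof (Rmin_l (d/2) e). pose proof (Rmin_r (d/2) e).
    split; [lra|]. split; [apply Rabs_def2 in Hv; lra|].
    apply (F (u, v)). eapply Rle_lt_trans; [apply Cmod_le_Re_Im|]. simpl.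
    unfold Rminus in Hu, Hv. lra. }
  apply rderiv_pair.
  - replace (RInt (fun t => Re (G' x t)) a b) with (RInt (fun t => Derive (fun u => Re (G u t)) x) a b).
    2:{ apply RInt_ext. intros t Ht. rewrite Rmin_left, Rmax_right in Ht by auto.
        apply is_derive_unique, rderiv_Re, HG; [|lra].
        rewrite Rminus_diag, Rabs_R0; auto. }
    apply (is_derive_RInt_param (fun s t => Re (G s t)) a b x).
    + eapply filter_imp; [|apply Hl]. intros s Hs t Ht. rewrite Rmin_left, Rmax_right in Ht by auto.
      eexists. apply rderiv_Re, HG; [exact Hs|lra].
    + intros t Ht eps. rewrite Rmin_left, Rmax_right in Ht by auto.
      destruct (Hc2 t Ht eps) as [d F]. exists d. intros u v Hu Hv.
      destruct (F u v Hu Hv) as [F1 [F2 F3]].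
      assert (E : forall u v, Rabs (u - x) < e -> a - e < v < b + e ->
        Derive (fun z => Re (G z v)) u = Re (G' u v))
        by (intros; apply is_derive_unique, rderiv_Re, HG; auto).
      rewrite (E u v F1 F2), (E x t); [|rewrite Rminus_diag, Rabs_R0; auto|lra].
      eapply Rle_lt_trans; [|apply F3]. apply (re_le_Cmod (G' u v - G' x t)).
    + eapply filter_imp; [|apply Hl]. intros s Hs. apply ex_RInt_Re. auto.
  - replace (RInt (fun t => Im (G' x t)) a b) with (RInt (fun t => Derive (fun u => Im (G u t)) x) a b).
    2:{ apply RInt_ext. intros t Ht. rewrite Rmin_left, Rmax_right in Ht by auto.
        apply is_derive_unique, rderiv_Im, HG; [|lra].
        rewrite Rminus_diag, Rabs_R0; auto. }
    apply (is_derive_RInt_param (fun s t => Im (G s t)) a b x).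
    + eapply filter_imp; [|apply Hl]. intros s Hs t Ht. rewrite Rmin_left, Rmax_right in Ht by auto.
      eexists. apply rderiv_Im, HG; [exact Hs|lra].
    + intros t Ht eps. rewrite Rmin_left, Rmax_right in Ht by auto.
      destruct (Hc2 t Ht eps) as [d F]. exists d. intros u v Hu Hv.
      destruct (F u v Hu Hv) as [F1 [F2 F3]].
      assert (E : forall u v, Rabs (u - x) < e -> a - e < v < b + e ->
        Derive (fun z => Im (G z v)) u = Im (G' u v))
        by (intros; apply is_derive_unique, rderiv_Im, HG; auto).
      rewrite (E u v F1 F2), (E x t); [|rewrite Rminus_diag, Rabs_R0; auto|lra].
      eapply Rle_lt_trans; [|apply F3]. apply (im_le_Cmod (G' u v - G' x t)).
    + eapply filter_imp; [|apply Hl]. intros s Hs. apply ex_RInt_Im. auto.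
Qed.

End Cint.

Lemma rderiv_zero_const (g : R -> C) (a b : R) : a <= b ->
  (forall t, a <= t <= b -> rderiv g t 0) -> g b = g a.
Proof.
  intros Hab H.
  assert (E : cint (fun _ => RtoC 0) a b = (g b - g a)%C).
  { apply cint_FTC; auto. intros; apply cont_const. }
  rewrite cint_const in E. replace (g b) with (g a + (g b - g a))%C by ring.
  rewrite <- E. ring.
Qed.

(** * Cauchy's formula *)

(** Only indices below [n] are summed, so that the empty sum exists; [sum_n] includes its last
    index, whence the shift by one in the next lemma. *)
Fixpoint psum (a : nat -> C) (z : C) (n : nat) : C :=
  match n with O => RtoC 0 | S p => (psum a z p + z ^ p * a p)%C end.

Lemma psum_sum_n (a : nat -> C) (z : C) (n : nat) :
  sum_n (G := C_NormedModule) (fun k => scal (pow_n (K := C_AbsRing) z k) (a k)) n = psum a z (S n).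
Proof.
  assert (E : forall k, scal (pow_n (K := C_AbsRing) z k) (a k) = (z ^ k * a k)%C :> C).
  { reflexivity. }
  induction n as [|n IH].
  - rewrite sum_O, E. simpl. ring.
  - rewrite sum_Sn, IH, E. reflexivity.
Qed.

Lemma is_pseries_psum (a : nat -> C) (z l : C) :
  is_pseries (K := C_AbsRing) (V := C_NormedModule) a z l <->
  forall eps, 0 < eps -> exists N, forall n, (N <= n)%nat -> Cmod (psum a z n - l) < eps.
Proof.
  split.
  - intros H eps He.
    destruct (H (fun y => Cmod (y - l) < eps)) as [N HN].
    { apply locally_C. exists (mkposreal eps He). intros y Hy. exact Hy. }
    exists (S N). intros n Hn. destruct n as [|n]; [lia|].
    rewrite <- psum_sum_n. apply HN. lia.
  - intros H P HP. apply locally_C in HP. destruct HP as [e He].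
    destruct (H e (cond_pos e)) as [N HN]. exists N. intros n Hn.
    apply He. rewrite psum_sum_n. apply HN. lia.
Qed.

Definition circ (r : R) (t : R) : C := (RtoC r * Cexp (Ci * RtoC t))%C.

Lemma Cmod_circ (r t : R) : 0 <= r -> Cmod (circ r t) = r.
Proof.
  intros Hr. unfold circ. rewrite Cmod_mult, Cmod_R, Rabs_pos_eq by auto.
  replace (Ci * RtoC t)%C with ((0, t) : C) by (apply Ceq; unfold Re, Im; simpl; ring).
  rewrite Cmod_Cexp_Im. ring.
Qed.

Lemma rderiv_circ (r t : R) : rderiv (circ r) t (Ci * circ r t)%C.
Proof.
  eapply has_deriv_eq.
  - apply has_deriv_mult; [apply has_deriv_const|].
    apply (has_deriv_comp RtoC Cexp); [apply cderiv_Cexp|].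
    apply has_deriv_mult; [apply has_deriv_const | apply has_deriv_id].
  - unfold circ. cbv beta. ring.
Qed.

Lemma circ_2PI (r : R) : circ r (2 * PI) = circ r 0.
Proof.
  unfold circ, Cexp. apply Ceq; unfold Re, Im; simpl;
  rewrite ?Rmult_0_l, ?Rmult_1_l, ?Rminus_0_r, ?Rplus_0_r, ?Rplus_0_l, ?sin_2PI, ?cos_2PI, ?sin_0, ?cos_0; reflexivity.
Qed.

Lemma rcont_circ (r t : R) : rcont (circ r) t.
Proof. eapply has_deriv_cont, rderiv_circ. Qed.

Lemma ccont_circ_Im (r : R) (p : C) : ccont (fun p => circ r (Im p)) p.
Proof.
  unfold circ. apply cont_mult; [apply cont_const|].
  apply (cont_comp _ Cexp); [eapply has_deriv_cont, cderiv_Cexp|].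
  apply cont_mult; [apply cont_const|]. apply cont_RtoC_Im, cont_id.
Qed.

(** The s-derivative of the integral is the integral of [G' s]. In both uses [G' s] is at the same
    time the t-derivative of a 2 pi-periodic function, so that its integral vanishes. *)
Lemma cint_homotopy (G G' : R -> R -> C) (a b e : R) : a <= b -> 0 < e ->
  (forall s t, - e < s < 1 + e -> rderiv (fun s => G s t) s (G' s t)) ->
  (forall s t, 0 <= s <= 1 -> ccont (fun p => G' (Re p) (Im p)) (s, t)) ->
  (forall s t, - e < s < 1 + e -> rcont (G s) t) ->
  (forall s, 0 <= s <= 1 -> cint (G' s) a b = 0) ->
  cint (G 1) a b = cint (G 0) a b.
Proof.
  intros Hab He HG HC HS H0.
  apply (rderiv_zero_const (fun s => cint (G s) a b)); [lra|].
  intros s Hs. rewrite <- (H0 s Hs).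
  apply (cint_param a b Hab G G' s e He).
  - intros s' t Hs' _. apply HG. apply Rabs_def2 in Hs'. lra.
  - intros t _. apply HC; auto.
  - intros s' t Hs' _. apply HS. apply Rabs_def2 in Hs'. lra.
Qed.

Section Cauchy.
Variables (r : R) (z : C).
Hypothesis Hz : Cmod z < r.

Lemma radius_pos : 0 < r.
Proof. pose proof (Cmod_ge_0 z). lra. Qed.

Lemma circ_neq_0 t : circ r t <> 0.
Proof. apply Cmod_gt_0. pose proof radius_pos. rewrite Cmod_circ; lra. Qed.

Lemma circ_sub_neq_0 t : (circ r t - z)%C <> 0.
Proof.
  apply Cmod_gt_0. pose proof (Cmod_sub_ge (circ r t) z). pose proof radius_pos.
  rewrite Cmod_circ in H; lra.
Qed.

(** Shrinking z to 0 through the points s z deforms the integrand into the constant 1. *)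
Lemma circ_kernel : cint (fun t => circ r t * / (circ r t - z))%C 0 (2 * PI) = RtoC (2 * PI).
Proof.
  pose proof radius_pos as Hr. pose proof (Cmod_ge_0 z) as Z0. pose proof PI_RGT_0 as HPI.
  (* With the margin (r - |z|) / r the points s z stay off the circle, since (1 + (r - |z|) / r) |z|
     = r - (r - |z|)^2 / r < r. *)
  assert (N0 : forall s t, - ((r - Cmod z) / r) < s < 1 + (r - Cmod z) / r ->
    (circ r t - RtoC s * z)%C <> 0).
  { intros s t Hs. apply Cmod_gt_0. pose proof (Cmod_sub_ge (circ r t) (RtoC s * z)).
    rewrite Cmod_circ, Cmod_mult, Cmod_R in H by lra.
    assert (Rabs s * Cmod z < r); [|lra].
    assert (Rabs s * Cmod z <= (1 + (r - Cmod z) / r) * Cmod z).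
    { apply Rmult_le_compat_r; auto. apply Rabs_le. lra. }
    assert ((1 + (r - Cmod z) / r) * Cmod z = r - (r - Cmod z) * (r - Cmod z) / r) by (field; lra).
    assert (0 < (r - Cmod z) * (r - Cmod z) / r); [|lra].
    apply Rdiv_lt_0_compat; auto. apply Rmult_lt_0_compat; lra. }
  assert (E : 0 < (r - Cmod z) / r) by (apply Rdiv_lt_0_compat; lra).
  pose proof (cint_homotopy (fun s t => circ r t * / (circ r t - RtoC s * z))%C
    (fun s t => circ r t * (z * / ((circ r t - RtoC s * z) * (circ r t - RtoC s * z))))%C
    0 (2 * PI) ((r - Cmod z) / r)) as H.
  cbv beta in H.
  transitivity (cint (fun t => circ r t * / (circ r t - RtoC 1 * z))%C 0 (2 * PI)).
  { apply cint_ext; [lra|]. intros; do 3 f_equal. ring. }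
  rewrite H; clear H; try lra.
  - transitivity (cint (fun t => RtoC 1) 0 (2 * PI)).
    + apply cint_ext; [lra|]. intros. replace (circ r t - 0 * z)%C with (circ r t) by ring.
      apply Cinv_r, circ_neq_0.
    + rewrite cint_const. rewrite Rminus_0_r. ring.
  - intros s t Hs. eapply has_deriv_eq.
    + apply has_deriv_mult; [apply has_deriv_const|].
      apply has_deriv_inv; [apply N0, Hs|].
      apply has_deriv_plus; [apply has_deriv_const|].
      apply (has_deriv_comp RtoC Copp (fun s => s * z)%C _ (- (1))%C).
      * apply (has_deriv_ext_loc _ (fun w => - (1) * w)%C _ _ _ 1); [lra|intros; ring|].
        eapply has_deriv_eq; [apply has_deriv_mult; [apply has_deriv_const|apply has_deriv_id]|cbv beta; ring].
      * apply has_deriv_mult; [apply has_deriv_id|apply has_deriv_const].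
    + cbv beta. change (circ r t + - (s * z))%C with (circ r t - s * z)%C. ring.
  - intros s t Hs. apply cont_mult; [apply ccont_circ_Im|].
    apply cont_mult; [apply cont_const|].
    assert (ccont (fun p => circ r (Im p) - RtoC (Re p) * z)%C (s, t)).
    { apply (cont_ext_loc _ (fun p => circ r (Im p) + RtoC (Re p) * (- z))%C _ _ 1); [lra|intros; ring|].
      apply cont_plus; [apply ccont_circ_Im|].
      apply cont_mult; [apply cont_RtoC_Re, cont_id|apply cont_const]. }
    apply cont_inv; [|apply cont_mult; auto].
    apply Cmult_neq_0; apply N0; simpl; lra.
  - intros s t Hs. apply cont_mult; [apply rcont_circ|].
    apply cont_inv; [apply N0, Hs|].
    apply cont_plus; [apply rcont_circ|apply cont_const].
  - intros s Hs.
    (* A periodic primitive in t of the s-derivative: the factor i of the velocity of [circ] and the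
       factor i put in front multiply to -1, which cancels the sign from differentiating the
       inverse. *)
    rewrite (cint_FTC 0 (2 * PI) ltac:(lra) (fun t => Ci * z * / (circ r t - RtoC s * z))%C).
    + rewrite circ_2PI. ring.
    + intros t _. eapply has_deriv_eq.
      * apply has_deriv_mult; [apply has_deriv_const|].
        apply has_deriv_inv; [apply N0; lra|].
        apply has_deriv_plus; [apply rderiv_circ|apply has_deriv_const].
      * cbv beta. change (circ r t + - (s * z))%C with (circ r t - s * z)%C.
        replace (0 * / (circ r t - s * z) + Ci * z * (- / ((circ r t - s * z) * (circ r t - s * z)) * (Ci * circ r t + 0)))%C
         with (- (Ci * Ci) * (circ r t * (z * / ((circ r t - s * z) * (circ r t - s * z)))))%C by ring.
        replace (Ci * Ci)%C with (- (1))%C by (apply Ceq; unfold Re, Im; simpl; ring). ring.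
    + intros t _. apply cont_mult; [apply rcont_circ|].
      apply cont_mult; [apply cont_const|].
      assert (rcont (fun t => circ r t - RtoC s * z)%C t)
        by (apply cont_plus; [apply rcont_circ|apply cont_const]).
      apply cont_inv; [apply Cmult_neq_0; apply N0; lra|apply cont_mult; auto].
Qed.

(** The circle is contracted to z through z + s (circ - z) inside the argument of f alone, the
    kernel staying fixed. The s-derivative produces a factor circ - z that cancels the denominator
    of the kernel; at s = 0 only the integral of the kernel remains. *)
Lemma cauchy_formula (f f' : C -> C) (R0 : R) : r < R0 ->
  (forall w, Cmod w < R0 -> cderiv f w (f' w)) ->
  (forall w, Cmod w < R0 -> ccont f' w) ->
  cint (fun t => f (circ r t) * (circ r t * / (circ r t - z)))%C 0 (2 * PI) = (RtoC (2 * PI) * f z)%C.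
Proof.
  intros HR Hd Hc.
  pose proof radius_pos as Hr. pose proof (Cmod_ge_0 z) as Z0. pose proof PI_RGT_0 as HPI.
  (* For s in (- e, 1 + e) one has |1 - s| + |s| <= 1 + 2 e, and (1 + 2 e) r = r + (R0 - r) / 2 is
     still below R0. *)
  set (e := (R0 - r) / (4 * r)).
  assert (E : 0 < e) by (apply Rdiv_lt_0_compat; lra).
  assert (N0 : forall s t, - e < s < 1 + e -> Cmod (z + RtoC s * (circ r t - z)) < R0).
  { intros s t Hs. replace (z + RtoC s * (circ r t - z))%C with (RtoC (1 - s) * z + RtoC s * circ r t)%C
      by (rewrite RtoC_minus; ring).
    eapply Rle_lt_trans; [apply Cmod_triangle|]. rewrite !Cmod_mult, !Cmod_R, Cmod_circ by lra.
    assert (Rabs (1 - s) * Cmod z <= Rabs (1 - s) * r) by (apply Rmult_le_compat_l; auto using Rabs_pos; lra).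
    assert (Rabs (1 - s) + Rabs s <= 1 + 2 * e).
    { unfold Rabs. destruct (Rcase_abs (1 - s)), (Rcase_abs s); lra. }
    assert ((Rabs (1 - s) + Rabs s) * r <= (1 + 2 * e) * r) by (apply Rmult_le_compat_r; lra).
    assert ((1 + 2 * e) * r = r + (R0 - r) / 2) by (unfold e; field; lra).
    lra. }
  pose proof (cint_homotopy (fun s t => f (z + RtoC s * (circ r t - z)) * (circ r t * / (circ r t - z)))%C
    (fun s t => f' (z + RtoC s * (circ r t - z)) * circ r t)%C
    0 (2 * PI) e) as H.
  cbv beta in H.
  transitivity (cint (fun t => f (z + RtoC 1 * (circ r t - z)) * (circ r t * / (circ r t - z)))%C 0 (2 * PI)).
  { apply cint_ext; [lra|]. intros; do 2 f_equal. ring. }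
  assert (K1 : forall t, rcont (fun t => circ r t * / (circ r t - z))%C t).
  { intros t. apply cont_mult; [apply rcont_circ|]. apply cont_inv; [apply circ_sub_neq_0|].
    apply cont_plus; [apply rcont_circ|apply cont_const]. }
  rewrite H; clear H; try lra.
  - transitivity (cint (fun t => f z * (circ r t * / (circ r t - z)))%C 0 (2 * PI)).
    + apply cint_ext; [lra|]. intros. do 2 f_equal. ring.
    + rewrite cint_scal, circ_kernel; [ring|lra|]. intros; apply K1.
  - intros s t Hs. eapply has_deriv_eq.
    + apply has_deriv_mult; [|apply has_deriv_const].
      apply (has_deriv_comp RtoC f); [apply Hd, N0, Hs|].
      apply has_deriv_plus; [apply has_deriv_const|].
      apply has_deriv_mult; [apply has_deriv_id|apply has_deriv_const].
    + cbv beta. field. apply circ_sub_neq_0.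
  - intros s t Hs. apply cont_mult; [|apply ccont_circ_Im].
    apply (cont_comp _ f').
    + apply Hc, N0. simpl. lra.
    + apply cont_plus; [apply cont_const|]. apply cont_mult; [apply cont_RtoC_Re, cont_id|].
      apply cont_plus; [apply ccont_circ_Im|apply cont_const].
  - intros s t Hs. apply cont_mult; [|apply K1].
    apply (cont_comp _ f); [eapply has_deriv_cont, Hd, N0, Hs|].
    apply cont_plus; [apply cont_const|]. apply cont_mult; [apply cont_const|].
    apply cont_plus; [apply rcont_circ|apply cont_const].
  - intros s Hs.
    assert (K2 : forall t, rcont (fun t => f' (z + RtoC s * (circ r t - z)) * circ r t)%C t).
    { intros t. apply cont_mult; [|apply rcont_circ].
      apply (cont_comp _ f'); [apply Hc, N0; lra|].
      apply cont_plus; [apply cont_const|]. apply cont_mult; [apply cont_const|].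
      apply cont_plus; [apply rcont_circ|apply cont_const]. }
    (* The primitive - i f(z + s (circ - z)) / s breaks down at s = 0, where the integrand is f'(z)
       circ and - i f'(z) circ takes its place. *)
    destruct (Req_dec s 0) as [->|Hs0].
    + rewrite (cint_FTC 0 (2 * PI) ltac:(lra) (fun t => f' z * (- Ci) * circ r t)%C); [| |intros; apply K2].
      * rewrite circ_2PI. ring.
      * intros t _. eapply has_deriv_eq.
        -- apply has_deriv_mult; [apply has_deriv_const|apply rderiv_circ].
        -- cbv beta. replace (z + 0 * (circ r t - z))%C with z by ring.
           transitivity (- (Ci * Ci) * (f' z * circ r t))%C; [ring|].
           replace (Ci * Ci)%C with (- (1))%C by (apply Ceq; unfold Re, Im; simpl; ring). ring.
    + assert (Hs1 : RtoC s <> 0) by (intros K; apply Hs0, RtoC_inj, K).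
      rewrite (cint_FTC 0 (2 * PI) ltac:(lra) (fun t => (- Ci * / RtoC s) * f (z + RtoC s * (circ r t - z)))%C); [| |intros; apply K2].
      * rewrite circ_2PI. ring.
      * intros t _. eapply has_deriv_eq.
        -- apply has_deriv_mult; [apply has_deriv_const|].
           apply (has_deriv_comp RtoC f); [apply Hd, N0; lra|].
           apply has_deriv_plus; [apply has_deriv_const|].
           apply has_deriv_mult; [apply has_deriv_const|].
           apply has_deriv_plus; [apply rderiv_circ|apply has_deriv_const].
        -- cbv beta. change (circ r t + - z)%C with (circ r t - z)%C.
           transitivity (- (Ci * Ci) * (f' (z + RtoC s * (circ r t - z)) * circ r t))%C; [field; auto|].
           replace (Ci * Ci)%C with (- (1))%C by (apply Ceq; unfold Re, Im; simpl; ring). ring.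
Qed.

End Cauchy.

(** * Power series *)

Lemma rcont_bounded (g : R -> C) (a b : R) : a <= b -> (forall t, a <= t <= b -> rcont g t) ->
  exists M, 0 <= M /\ forall t, a <= t <= b -> Cmod (g t) <= M.
Proof.
  intros Hab Hg.
  destruct (continuity_ab_maj (fun t => Cmod (g t)) a b Hab) as [x [Hx _]].
  - intros t Ht eps He. destruct (Hg t Ht eps He) as [e [H1 F]].
    exists e; split; auto. intros s [_ Hs]. simpl in *. unfold R_dist in *.
    eapply Rle_lt_trans; [|apply (F s); rewrite <- RtoC_minus, Cmod_R; exact Hs].
    pose proof (Cmod_sub_ge (g s) (g t)). pose proof (Cmod_sub_ge (g t) (g s)).
    rewrite (Cmod_sub_sym (g t)) in H0. apply Rabs_le. lra.
  - exists (Cmod (g x)). split; [apply Cmod_ge_0|]. exact Hx.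
Qed.

(** The kernel c / (c - z) is expanded as a finite geometric sum in z / c with its exact remainder,
    so no sum is ever exchanged with an integral. *)
Lemma cauchy_expansion (r : R) (g : R -> C) : 0 < r ->
  (forall t, 0 <= t <= 2 * PI -> rcont g t) ->
  forall z, Cmod z < r ->
  is_pseries (K := C_AbsRing) (V := C_NormedModule)
    (fun k => cint (fun t => g t * (/ circ r t) ^ k)%C 0 (2 * PI)) z
    (cint (fun t => g t * (circ r t * / (circ r t - z)))%C 0 (2 * PI)).
Proof.
  intros Hr Hg z Hz. pose proof PI_RGT_0 as HPI.
  set (A := fun k => cint (fun t => g t * (/ circ r t) ^ k)%C 0 (2 * PI)).
  (* z^n [K n] is the remainder after n terms, and [K O] is the whole integral. Since the kernel is
     bounded on the circle, the remainder is O((|z| / r)^n). *)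
  set (K := fun n => cint (fun t => g t * (/ circ r t) ^ n * (circ r t * / (circ r t - z)))%C 0 (2 * PI)).
  assert (Cu : forall k t, rcont (fun t => (/ circ r t) ^ k)%C t).
  { intros k t. induction k as [|k IH]; [apply (cont_const RtoC (RtoC 1))|].
    apply (cont_ext_loc _ (fun t => / circ r t * (/ circ r t) ^ k)%C _ _ 1); [lra|reflexivity|].
    apply cont_mult; auto. apply cont_inv; [apply (circ_neq_0 r z Hz)|apply rcont_circ]. }
  assert (Ck : forall t, rcont (fun t => circ r t * / (circ r t - z))%C t).
  { intros t. apply cont_mult; [apply rcont_circ|]. apply cont_inv; [apply circ_sub_neq_0, Hz|].
    apply cont_plus; [apply rcont_circ|apply cont_const]. }
  assert (CA : forall k t, 0 <= t <= 2 * PI -> rcont (fun t => g t * (/ circ r t) ^ k)%C t)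
    by (intros; apply cont_mult; auto).
  assert (CK : forall k t, 0 <= t <= 2 * PI ->
    rcont (fun t => g t * (/ circ r t) ^ k * (circ r t * / (circ r t - z)))%C t)
    by (intros; apply cont_mult; auto).
  assert (Rec : forall n, K n = (A n + z * K (S n))%C).
  { intros n. unfold A, K. rewrite <- cint_scal, <- cint_plus; try lra; auto.
    - apply cint_ext; [lra|]. intros t Ht. rewrite Cpow_S. field.
      split; [apply circ_sub_neq_0, Hz|apply (circ_neq_0 r z Hz)].
    - intros t Ht. apply cont_mult; [apply cont_const|apply CK, Ht]. }
  assert (Sum : forall n, K O = (psum A z n + z ^ n * K n)%C).
  { induction n as [|n IH]; [simpl; ring|]. rewrite IH, (Rec n). simpl. ring. }
  destruct (rcont_bounded g 0 (2 * PI) ltac:(lra) Hg) as [M [HM0 HM]].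
  replace (cint (fun t => g t * (circ r t * / (circ r t - z)))%C 0 (2 * PI)) with (K O).
  2:{ apply cint_ext; [lra|]. intros t _. simpl. ring. }
  set (B := 2 * (M * (r / (r - Cmod z)) * (2 * PI - 0))).
  pose proof (Cmod_ge_0 z) as Z0.
  assert (HB : 0 <= B).
  { unfold B. apply Rmult_le_pos; [lra|]. apply Rmult_le_pos; [|lra].
    apply Rmult_le_pos; [lra|]. apply Rlt_le, Rdiv_lt_0_compat; lra. }
  assert (HK : forall n, Cmod (z ^ n * K n) <= B * (Cmod z / r) ^ n).
  { intros n. rewrite Cmod_mult, Cmod_pow.
    assert (HKn : Cmod (K n) <= 2 * (M * (/ r) ^ n * (r / (r - Cmod z)) * (2 * PI - 0))).
    { unfold K. apply cint_bound; [lra|intros; apply CK; auto|].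
      intros t Ht. rewrite !Cmod_mult, Cmod_pow, !Cmod_inv, Cmod_circ;
        [|lra|apply circ_sub_neq_0, Hz|apply (circ_neq_0 r z Hz)].
      assert (0 <= (/ r) ^ n) by (apply pow_le; left; apply Rinv_0_lt_compat; lra).
      apply Rmult_le_compat.
      - apply Rmult_le_pos; auto using Cmod_ge_0.
      - apply Rmult_le_pos; [lra|]. left. apply Rinv_0_lt_compat, Cmod_gt_0, circ_sub_neq_0, Hz.
      - apply Rmult_le_compat_r; auto.
      - apply Rmult_le_compat_l; [lra|]. apply Rinv_le_contravar; [lra|].
        pose proof (Cmod_sub_ge (circ r t) z). rewrite Cmod_circ in H0; lra. }
    eapply Rle_trans; [apply Rmult_le_compat_l; [apply pow_le; auto|apply HKn]|].
    unfold B, Rdiv. rewrite (Rpow_mult_distr (Cmod z) (/ r)). right. ring. }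
  apply is_pseries_psum. intros eps He.
  assert (Hq : Rabs (Cmod z / r) < 1).
  { rewrite Rabs_pos_eq; [|apply Rdiv_le_0_compat; lra]. apply Rlt_div_l; lra. }
  destruct (pow_lt_1_zero (Cmod z / r) Hq (eps / (B + 1))) as [N HN].
  { apply Rdiv_lt_0_compat; lra. }
  exists N. intros n Hn. rewrite (Sum n).
  replace (psum A z n - (psum A z n + z ^ n * K n))%C with (- (z ^ n * K n))%C by ring.
  rewrite Cmod_opp. eapply Rle_lt_trans; [apply HK|].
  specialize (HN n ltac:(lia)). apply Rabs_def2 in HN. destruct HN as [HN _].
  assert (0 <= (Cmod z / r) ^ n) by (apply pow_le, Rdiv_le_0_compat; lra).
  apply Rle_lt_trans with ((Cmod z / r) ^ n * (B + 1)); [nra|].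
  replace eps with (eps / (B + 1) * (B + 1)) by (field; lra). apply Rmult_lt_compat_r; lra.
Qed.

Lemma psum_scal (c : C) (a : nat -> C) (z : C) n : psum (fun k => c * a k)%C z n = (c * psum a z n)%C.
Proof. induction n as [|n IH]; simpl; [ring|]. rewrite IH. ring. Qed.

Lemma is_pseries_cscal (c : C) (a : nat -> C) (z l : C) :
  is_pseries (K := C_AbsRing) (V := C_NormedModule) a z l ->
  is_pseries (K := C_AbsRing) (V := C_NormedModule) (fun k => c * a k)%C z (c * l)%C.
Proof.
  rewrite !is_pseries_psum. intros H eps He. pose proof (Cmod_ge_0 c) as Hc.
  destruct (H (eps / (Cmod c + 1))) as [N HN]; [apply Rdiv_lt_0_compat; lra|].
  exists N. intros n Hn. specialize (HN n Hn). rewrite psum_scal.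
  replace (c * psum a z n - c * l)%C with (c * (psum a z n - l))%C by ring. rewrite Cmod_mult.
  pose proof (Cmod_ge_0 (psum a z n - l)).
  apply Rle_lt_trans with ((Cmod c + 1) * Cmod (psum a z n - l)); [nra|].
  replace eps with ((Cmod c + 1) * (eps / (Cmod c + 1))) by (field; lra).
  apply Rmult_lt_compat_l; lra.
Qed.

Lemma C1_pseries (f f' : C -> C) (R0 : R) : 0 < R0 ->
  (forall w, Cmod w < R0 -> cderiv f w (f' w)) ->
  (forall w, Cmod w < R0 -> ccont f' w) ->
  exists (a : nat -> C) (r : R), 0 < r /\ forall z, Cmod z < r ->
    is_pseries (K := C_AbsRing) (V := C_NormedModule) a z (f z).
Proof.
  intros HR Hd Hc. pose proof PI_RGT_0 as HPI.
  exists (fun k => / RtoC (2 * PI) * cint (fun t => f (circ (R0 / 2) t) * (/ circ (R0 / 2) t) ^ k) 0 (2 * PI))%C, (R0 / 2).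
  split; [lra|]. intros z Hz.
  assert (P0 : RtoC (2 * PI) <> 0) by (intros K; apply RtoC_inj in K; lra).
  replace (f z) with (/ RtoC (2 * PI) * (RtoC (2 * PI) * f z))%C by (field; auto).
  rewrite <- (cauchy_formula (R0 / 2) z Hz f f' R0); auto; [|lra].
  apply is_pseries_cscal.
  apply (cauchy_expansion (R0 / 2) (fun t => f (circ (R0 / 2) t))); [lra| |auto].
  intros t _. apply (cont_comp RtoC f); [|apply rcont_circ].
  eapply has_deriv_cont, Hd. rewrite Cmod_circ; lra.
Qed.

(** The mixed hypothesis is made for difference quotients (f z - f 0) / z: at 0 they are known
    through a power series, elsewhere through their derivative. *)
Lemma locally_C1_analytic (f : C -> C) :
  (forall z0, in_disk z0 ->
    (exists (a : nat -> C) (r : R), 0 < r /\ forall z, Cmod (z - z0) < r ->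
      is_pseries (K := C_AbsRing) (V := C_NormedModule) a (z - z0)%C (f z)) \/
    (exists (f' : C -> C) (e : R), 0 < e /\ forall z, Cmod (z - z0) < e -> cderiv f z (f' z) /\ ccont f' z)) ->
  analytic_on_disk f.
Proof.
  intros H z0 Hz0. destruct (H z0 Hz0) as [(a & r & Hr & Ha)|(f' & e & He & Hf)].
  - exists a, r; auto.
  - destruct (C1_pseries (fun h => f (h + z0)%C) (fun h => f' (h + z0)%C) e He) as (a & r & Hr & Ha).
    + intros w Hw. eapply has_deriv_eq.
      * apply (has_deriv_comp _ f).
        -- apply Hf. replace (w + z0 - z0)%C with w by ring. auto.
        -- apply has_deriv_plus; [apply has_deriv_id|apply has_deriv_const].
      * ring.
    + intros w Hw. apply (cont_comp _ f').
      * apply Hf. replace (w + z0 - z0)%C with w by ring. auto.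
      * apply cont_plus; [apply cont_id|apply cont_const].
    + exists a, r. split; auto. intros z _ Hz. specialize (Ha _ Hz).
      cbv beta in Ha. replace (z - z0 + z0)%C with z in Ha by ring. exact Ha.
Qed.

Lemma C1_analytic (f f' : C -> C) : (forall z, in_disk z -> cderiv f z (f' z)) ->
  (forall z, in_disk z -> ccont f' z) -> analytic_on_disk f.
Proof.
  intros Hd Hc. apply locally_C1_analytic. intros z0 Hz0. right.
  exists f', (1 - Cmod z0). unfold in_disk in *. split; [lra|]. intros z Hz.
  assert (Cmod z < 1).
  { pose proof (Cmod_sub_ge z z0). lra. }
  auto.
Qed.

(* |w^n - z^n - n z^(n-1) (w - z)| is O(n^2 rho^(n-2) |w - z|^2), multiplied by rho^2 to keep
   nonnegative exponents; [pred 0 = 0] is harmless as its coefficient vanishes. *)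
Lemma pow_taylor_bound (rho : R) (z w : C) (n : nat) : Cmod z <= rho -> Cmod w <= rho ->
  Cmod (w ^ n - z ^ n - RtoC (INR n) * z ^ pred n * (w - z)) * rho ^ 2
    <= INR n ^ 2 * rho ^ n * Cmod (w - z) ^ 2.
Proof.
  intros Hz Hw. pose proof (Cmod_ge_0 z) as Z0. pose proof (Cmod_ge_0 w) as W0.
  induction n as [|n IH].
  - simpl. replace (1 - 1 - 0 * 1 * (w - z))%C with (RtoC 0) by ring. rewrite Cmod_0. lra.
  - set (D := Cmod (w - z)) in *. assert (D0 : 0 <= D) by apply Cmod_ge_0.
    assert (P : Cmod (w ^ S n - z ^ S n - RtoC (INR (S n)) * z ^ pred (S n) * (w - z)) <=
      rho * Cmod (w ^ n - z ^ n - RtoC (INR n) * z ^ pred n * (w - z)) +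
      INR n * rho ^ pred n * D ^ 2).
    { replace (w ^ S n - z ^ S n - RtoC (INR (S n)) * z ^ pred (S n) * (w - z))%C with
        (w * (w ^ n - z ^ n - RtoC (INR n) * z ^ pred n * (w - z)) +
         RtoC (INR n) * z ^ pred n * ((w - z) * (w - z)))%C.
      2:{ destruct n as [|n]; [simpl; ring|]. rewrite !S_INR, !RtoC_plus. simpl. ring. }
      eapply Rle_trans; [apply Cmod_triangle|]. rewrite !Cmod_mult, Cmod_R, Cmod_pow.
      fold D. rewrite Rabs_pos_eq by apply pos_INR.
      apply Rplus_le_compat.
      - apply Rmult_le_compat_r; auto using Cmod_ge_0.
      - replace (D ^ 2) with (D * D) by ring. apply Rmult_le_compat_r; [nra|].
        apply Rmult_le_compat_l; [apply pos_INR|]. apply pow_incr. auto. }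
    assert (HR : INR n * rho ^ pred n * rho ^ 2 = INR n * rho ^ S n).
    { destruct n as [|n]; [simpl; ring|]. simpl. ring. }
    assert (R2 : 0 <= rho ^ 2) by (apply pow_le; lra).
    apply Rmult_le_compat_r with (r := rho ^ 2) in P; auto.
    eapply Rle_trans; [apply P|]. rewrite Rmult_plus_distr_r.
    apply Rmult_le_compat_l with (r := rho) in IH; [|lra].
    replace (INR n * rho ^ pred n * D ^ 2 * rho ^ 2) with (INR n * rho ^ S n * D ^ 2)
      by (rewrite <- HR; ring).
    assert (Hn : 0 <= INR n) by apply pos_INR. rewrite S_INR.
    assert (0 <= rho ^ S n * D ^ 2) by (apply Rmult_le_pos; apply pow_le; lra).
    simpl in *. nra.
Qed.

(** n^2 is at most (n + 1) (n + 2), the n-th coefficient of the second derivative of the geometric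
    series, and differentiation does not change the radius of convergence. *)
Lemma ex_series_square_geom (q : R) : 0 <= q < 1 -> ex_series (fun n => INR n ^ 2 * q ^ n).
Proof.
  intros Hq.
  assert (H : ex_series (fun n => Rabs (PS_derive (PS_derive (fun _ => 1)) n * q ^ n))).
  { apply CV_disk_inside. rewrite !CV_radius_derive.
    apply Rbar_lt_le_trans with (Rabs ((1 + q) / 2)).
    - simpl. rewrite !Rabs_pos_eq; lra.
    - apply CV_radius_bounded. exists 1. intros n. rewrite Rmult_1_l, <- RPow_abs.
      apply Rle_trans with (1 ^ n); [|rewrite pow1; lra]. apply pow_incr. split; [apply Rabs_pos|].
      rewrite ?Rabs_Rabsolu. rewrite Rabs_pos_eq; lra. }
  revert H. apply (ex_series_le (V := R_CompleteNormedModule)). intros n. change (Rabs (INR n ^ 2 * q ^ n) <= Rabs (PS_derive (PS_derive (fun _ => 1)) n * q ^ n)).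
  assert (0 <= q ^ n) by (apply pow_le; lra). pose proof (pos_INR n).
  unfold PS_derive. rewrite !S_INR.
  rewrite (Rabs_pos_eq (INR n ^ 2 * q ^ n)) by (apply Rmult_le_pos; [apply pow_le|]; auto).
  eapply Rle_trans; [|apply Rle_abs]. apply Rmult_le_compat_r; auto. nra.
Qed.

Definition deriv_coef (a : nat -> C) (n : nat) : C := (RtoC (INR (S n)) * a (S n))%C.

Lemma Cseq_lim_unique (u : nat -> C) (l l' : C) :
  (forall eps, 0 < eps -> exists N, forall n, (N <= n)%nat -> Cmod (u n - l) < eps) ->
  (forall eps, 0 < eps -> exists N, forall n, (N <= n)%nat -> Cmod (u n - l') < eps) -> l = l'.
Proof.
  intros H H'. destruct (Ceq_dec l l') as [|N]; auto. exfalso.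
  assert (P : 0 < Cmod (l - l')) by (apply Cmod_gt_0, Cminus_eq_contra, N).
  destruct (H (Cmod (l - l') / 2) ltac:(lra)) as [N1 H1].
  destruct (H' (Cmod (l - l') / 2) ltac:(lra)) as [N2 H2].
  specialize (H1 (N1 + N2)%nat ltac:(lia)). specialize (H2 (N1 + N2)%nat ltac:(lia)).
  rewrite Cmod_sub_sym in H1.
  pose proof (Cmod_triangle (l - u (N1 + N2)%nat) (u (N1 + N2)%nat - l')).
  replace (l - u (N1 + N2)%nat + (u (N1 + N2)%nat - l'))%C with (l - l')%C in H0 by ring. lra.
Qed.

Lemma pseries_terms_bounded (a : nat -> C) (z l : C) :
  is_pseries (K := C_AbsRing) (V := C_NormedModule) a z l ->
  exists M, 0 <= M /\ forall n, Cmod (a n) * Cmod z ^ n <= M.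
Proof.
  intros H. rewrite is_pseries_psum in H. destruct (H 1 Rlt_0_1) as [N HN].
  assert (F : exists M, 0 <= M /\ forall n, (n <= N)%nat -> Cmod (a n) * Cmod z ^ n <= M).
  { clear. induction N as [|N [M [HM IH]]].
    - exists (Cmod (a O) * Cmod z ^ 0). split.
      + apply Rmult_le_pos; [apply Cmod_ge_0|apply pow_le, Cmod_ge_0].
      + intros n Hn. replace n with O by lia. lra.
    - exists (Rmax M (Cmod (a (S N)) * Cmod z ^ S N)). split.
      + eapply Rle_trans; [apply HM|apply Rmax_l].
      + intros n Hn. destruct (Nat.eq_dec n (S N)) as [->|]; [apply Rmax_r|].
        eapply Rle_trans; [apply IH; lia|apply Rmax_l]. }
  (* Beyond [N] a term is the difference of two partial sums, each within 1 of the limit. *)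
  destruct F as [M [HM F]]. exists (Rmax M 2). split.
  { eapply Rle_trans; [apply HM|apply Rmax_l]. }
  intros n. destruct (Compare_dec.le_dec n N) as [Hn|Hn].
  { eapply Rle_trans; [apply F, Hn|apply Rmax_l]. }
  pose proof (HN n ltac:(lia)) as H1. pose proof (HN (S n) ltac:(lia)) as H2. simpl in H2.
  eapply Rle_trans; [|apply Rmax_r]. rewrite <- Cmod_pow, Rmult_comm, <- Cmod_mult.
  replace (z ^ n * a n)%C with ((psum a z n + z ^ n * a n - l) - (psum a z n - l))%C by ring.
  eapply Rle_trans; [apply Cmod_sub_le|]. lra.
Qed.

(** [pow_taylor_bound] summed over the terms. As [B] does not depend on n, the estimate passes to
    the limit. Differentiation removes the constant term, whence [pred n], with [pred 0] harmless
    because both sums are then empty. *)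
Lemma psum_deriv_bound (a : nat -> C) (rho B : R) (z w : C) n :
  Cmod z <= rho -> Cmod w <= rho ->
  (forall m, sum_n (fun k => Cmod (a k) * (INR k ^ 2 * rho ^ k)) m <= B) ->
  Cmod (psum a w n - psum a z n - psum (deriv_coef a) z (pred n) * (w - z)) * rho ^ 2 <=
    B * Cmod (w - z) ^ 2.
Proof.
  intros Hz Hw HS.
  assert (S0 : 0 <= rho ^ 2) by (apply pow_le; pose proof (Cmod_ge_0 z); lra).
  assert (P : forall m, Cmod (psum a w (S m) - psum a z (S m) - psum (deriv_coef a) z m * (w - z)) * rho ^ 2 <=
    sum_n (fun k => Cmod (a k) * (INR k ^ 2 * rho ^ k)) m * Cmod (w - z) ^ 2).
  { induction m as [|m IH].
    - rewrite sum_O. simpl. replace (0 + 1 * a O - (0 + 1 * a O) - 0 * (w - z))%C with (RtoC 0) by ring.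
      rewrite Cmod_0. lra.
    - rewrite sum_Sn.
      pose proof (pow_taylor_bound rho z w (S m) Hz Hw) as HB.
      replace (psum a w (S (S m)) - psum a z (S (S m)) - psum (deriv_coef a) z (S m) * (w - z))%C with
        ((psum a w (S m) - psum a z (S m) - psum (deriv_coef a) z m * (w - z)) +
         a (S m) * (w ^ S m - z ^ S m - RtoC (INR (S m)) * z ^ pred (S m) * (w - z)))%C.
      2:{ unfold deriv_coef. cbn [psum pred]. ring. }
      eapply Rle_trans; [apply Rmult_le_compat_r; [apply S0|apply Cmod_triangle]|].
      rewrite Rmult_plus_distr_r.
      rewrite Cmod_mult.
      apply Rmult_le_compat_l with (r := Cmod (a (S m))) in HB; [|apply Cmod_ge_0].
      match goal with |- _ <= ?X * _ => change X with
        (sum_n (fun k => Cmod (a k) * (INR k ^ 2 * rho ^ k)) m + Cmod (a (S m)) * (INR (S m) ^ 2 * rho ^ S m)) end.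
      lra. }
  pose proof (HS O) as HS0. rewrite sum_O in HS0.
  assert (0 <= Cmod (w - z) ^ 2) by apply pow_le, Cmod_ge_0.
  destruct n as [|n].
  - simpl psum. replace (0 - 0 - 0 * (w - z))%C with (RtoC 0) by ring. rewrite Cmod_0.
    simpl INR in HS0. assert (0 <= B) by (simpl in HS0; lra). nra.
  - eapply Rle_trans; [apply P|]. apply Rmult_le_compat_r; auto.
Qed.

(** All partial sums obey one quadratic bound for the error of their linear approximation, hence so
    does the limit; this replaces any argument on uniform convergence of derivatives. *)
Lemma pseries_deriv (a : nat -> C) (P : C -> C) (r : R) :
  (forall z, Cmod z < r -> is_pseries (K := C_AbsRing) (V := C_NormedModule) a z (P z)) ->
  forall z, Cmod z < r -> exists D, cderiv P z D /\
    is_pseries (K := C_AbsRing) (V := C_NormedModule) (deriv_coef a) z D.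
Proof.
  intros HP z Hz. pose proof (Cmod_ge_0 z) as Z0.
  (* Nested radii |z| < rho < rho1 < r: convergence at rho1 bounds |a_k| rho1^k, which makes the sum
     of k^2 |a_k| rho^k finite, and the points w may range over |w| <= rho. *)
  set (rho1 := (Cmod z + 2 * r) / 3). set (rho := (2 * Cmod z + r) / 3).
  assert (R1 : Cmod z < rho) by (unfold rho; lra).
  assert (R2 : rho < rho1) by (unfold rho, rho1; lra).
  assert (R3 : rho1 < r) by (unfold rho1; lra).
  destruct (pseries_terms_bounded a (RtoC rho1) (P (RtoC rho1))) as [M [HM0 HM]].
  { apply HP. rewrite Cmod_R, Rabs_pos_eq; lra. }
  rewrite Cmod_R, Rabs_pos_eq in HM by lra.
  set (u := fun k => Cmod (a k) * (INR k ^ 2 * rho ^ k)).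
  assert (u0 : forall k, 0 <= u k).
  { intros k. unfold u. apply Rmult_le_pos; [apply Cmod_ge_0|].
    apply Rmult_le_pos; [apply pow_le, pos_INR|apply pow_le; lra]. }
  assert (Hu : ex_series u).
  { apply (ex_series_le (V := R_CompleteNormedModule) u (fun k => M * (INR k ^ 2 * (rho / rho1) ^ k))).
    - intros k. change (Rabs (u k) <= M * (INR k ^ 2 * (rho / rho1) ^ k)).
      rewrite Rabs_pos_eq by auto. unfold u, Rdiv. rewrite Rpow_mult_distr, pow_inv.
      assert (Pk : 0 < rho1 ^ k) by (apply pow_lt; lra).
      replace (Cmod (a k) * (INR k ^ 2 * rho ^ k)) with
        ((Cmod (a k) * rho1 ^ k) * (INR k ^ 2 * (rho ^ k * / rho1 ^ k))) by (field; lra).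
      apply Rmult_le_compat_r; auto.
      apply Rmult_le_pos; [apply pow_le, pos_INR|]. apply Rmult_le_pos; [apply pow_le; lra|].
      left; apply Rinv_0_lt_compat; auto.
    - apply (ex_series_scal (V := R_NormedModule) M (fun k => INR k ^ 2 * (rho / rho1) ^ k)). apply ex_series_square_geom.
      split; [apply Rdiv_le_0_compat; lra|]. apply Rlt_div_l; lra. }
  destruct Hu as [B HB].
  assert (HB1 : forall m, sum_n u m <= B).
  { intros m. apply (is_lim_seq_incr_compare (sum_n u)); [exact HB|].
    intros n. rewrite sum_Sn. change (sum_n u n <= sum_n u n + u (S n)). pose proof (u0 (S n)). lra. }
  assert (HD : ex_series (K := C_AbsRing) (V := C_NormedModule)
     (fun k => scal (pow_n (K := C_AbsRing) z k) (deriv_coef a k))).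
  { apply (ex_series_le (V := C_CompleteNormedModule) _ (fun k => / rho * u (S k))).
    - intros k. change (Cmod (z ^ k * (RtoC (INR (S k)) * a (S k))) <= / rho * u (S k)).
      rewrite !Cmod_mult, Cmod_pow, Cmod_R, Rabs_pos_eq by apply pos_INR. unfold u.
      replace (/ rho * (Cmod (a (S k)) * (INR (S k) ^ 2 * rho ^ S k))) with
        (rho ^ k * (INR (S k) ^ 2 * Cmod (a (S k)))) by (rewrite <- (tech_pow_Rmult rho k); field; lra).
      assert (1 <= INR (S k)) by (rewrite S_INR; pose proof (pos_INR k); lra).
      pose proof (Cmod_ge_0 (a (S k))).
      apply Rmult_le_compat.
      + apply pow_le; auto.
      + apply Rmult_le_pos; lra.
      + apply pow_incr; lra.
      + apply Rmult_le_compat_r; auto. nra.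
    - apply (ex_series_scal (V := R_NormedModule) (/ rho) (fun k => u (S k))). apply (ex_series_incr_1 u). exists B; exact HB. }
  destruct HD as [D HD]. exists D. split; [|exact HD].
  assert (Hr2 : 0 < rho ^ 2) by (apply pow_lt; lra).
  assert (B0 : 0 <= B) by (pose proof (HB1 O) as K; rewrite sum_O in K; pose proof (u0 O); lra).
  assert (Q : forall w, Cmod w <= rho ->
    Cmod (P w - P z - D * (w - z)) * rho ^ 2 <= B * Cmod (w - z) ^ 2).
  { intros w Hw. apply le_epsilon. intros eps He.
    pose proof (Cmod_ge_0 (w - z)) as D0.
    (* Replacing the limits at w, at z and of the derived series by partial sums costs eta (2 + |w -
       z|), which becomes eps after multiplication by rho^2. *)
    set (eta := eps / (rho ^ 2 * (2 + Cmod (w - z)))).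
    assert (Heta : 0 < eta) by (apply Rdiv_lt_0_compat; auto; apply Rmult_lt_0_compat; lra).
    destruct (proj1 (is_pseries_psum _ _ _) (HP w ltac:(lra)) eta Heta) as [N1 H1].
    destruct (proj1 (is_pseries_psum _ _ _) (HP z ltac:(lra)) eta Heta) as [N2 H2].
    destruct (proj1 (is_pseries_psum _ _ _) HD eta Heta) as [N3 H3].
    set (n := S (N1 + N2 + N3)).
    specialize (H1 n ltac:(lia)). specialize (H2 n ltac:(lia)). specialize (H3 (pred n) ltac:(unfold n; lia)).
    pose proof (psum_deriv_bound a rho B z w n ltac:(lra) Hw HB1) as K.
    set (X := (psum a w n - psum a z n - psum (deriv_coef a) z (pred n) * (w - z))%C) in *.
    assert (L : Cmod (P w - P z - D * (w - z)) <= Cmod X + eta * (2 + Cmod (w - z))).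
    { replace (P w - P z - D * (w - z))%C with
        (X + ((psum a z n - P z) - (psum a w n - P w) + (psum (deriv_coef a) z (pred n) - D) * (w - z)))%C
        by (unfold X; ring).
      eapply Rle_trans; [apply Cmod_triangle|]. apply Rplus_le_compat_l.
      eapply Rle_trans; [apply Cmod_triangle|]. rewrite Cmod_mult.
      pose proof (Cmod_sub_le (psum a z n - P z) (psum a w n - P w)).
      assert (Cmod (psum (deriv_coef a) z (pred n) - D) * Cmod (w - z) <= eta * Cmod (w - z))
        by (apply Rmult_le_compat_r; lra). lra. }
    apply Rmult_le_compat_r with (r := rho ^ 2) in L; [|lra].
    replace eps with (eta * (2 + Cmod (w - z)) * rho ^ 2) by (unfold eta; field; lra). lra. }
  apply (has_deriv_scaled _ _ _ _ ((B + 1) / rho ^ 2)); [apply Rdiv_lt_0_compat; lra|].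
  intros eps He. exists (Rmin eps (rho - Cmod z)). split; [apply Rmin_glb_lt; lra|].
  intros w Hw. pose proof (Rmin_l eps (rho - Cmod z)). pose proof (Rmin_r eps (rho - Cmod z)).
  assert (Cmod w <= rho) by (pose proof (Cmod_sub_ge w z); lra).
  specialize (Q w H1). pose proof (Cmod_ge_0 (w - z)) as D0. set (d := Cmod (w - z)) in *.
  apply Rmult_le_reg_r with (rho ^ 2); auto.
  replace ((B + 1) / rho ^ 2 * eps * d * rho ^ 2) with ((B + 1) * (eps * d)) by (field; lra).
  eapply Rle_trans; [apply Q|]. apply Rmult_le_compat; try lra; [apply pow_le; auto|]. nra.
Qed.

Lemma pseries_at_0 (a : nat -> C) (l : C) :
  is_pseries (K := C_AbsRing) (V := C_NormedModule) a (RtoC 0) l -> l = a O.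
Proof.
  intros H. rewrite is_pseries_psum in H. apply (Cseq_lim_unique (psum a 0)); auto.
  intros eps He. exists 1%nat. intros n Hn.
  assert (E : psum a 0 n = a O).
  { clear -Hn. induction n as [|n IH]; [lia|]. destruct n as [|n]; [simpl; ring|].
    cbn [psum] in *. rewrite IH by lia. simpl. ring. }
  rewrite E. replace (a O - a O)%C with (RtoC 0) by ring. rewrite Cmod_0. auto.
Qed.

Lemma pseries_C_derive (a : nat -> C) (P : C -> C) (r : R) :
  (forall z, Cmod z < r -> is_pseries (K := C_AbsRing) (V := C_NormedModule) a z (P z)) ->
  forall z, Cmod z < r -> cderiv P z (C_derive P z) /\
    is_pseries (K := C_AbsRing) (V := C_NormedModule) (deriv_coef a) z (C_derive P z).
Proof.
  intros H z Hz. destruct (pseries_deriv a P r H z Hz) as [D [H1 H2]].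
  rewrite (cderiv_C_derive _ _ _ H1). auto.
Qed.

Lemma in_disk_near (z0 z : C) : in_disk z0 -> Cmod (z - z0) < 1 - Cmod z0 -> in_disk z.
Proof. unfold in_disk. intros. pose proof (Cmod_sub_ge z z0). lra. Qed.

Lemma analytic_derivable (f : C -> C) : analytic_on_disk f ->
  (forall z, in_disk z -> cderiv f z (C_derive f z)) /\ analytic_on_disk (C_derive f).
Proof.
  intros Hf.
  assert (L : forall z0, in_disk z0 -> exists (a : nat -> C) (r : R), 0 < r /\
    forall z, Cmod (z - z0) < r -> cderiv f z (C_derive f z) /\
      is_pseries (K := C_AbsRing) (V := C_NormedModule) a (z - z0)%C (C_derive f z)).
  { intros z0 Hz0. destruct (Hf z0 Hz0) as (a & r & Hr & Ha).
    exists (deriv_coef a), (Rmin r (1 - Cmod z0)). split; [apply Rmin_glb_lt; auto; unfold in_disk in *; lra|].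
    intros z Hz.
    destruct (pseries_deriv a (fun h => f (h + z0)%C) (Rmin r (1 - Cmod z0))) with (z := (z - z0)%C) as [D [H1 H2]]; auto.
    - intros h Hh. cbv beta. replace (is_pseries a h (f (h + z0)%C)) with (is_pseries a (h + z0 - z0)%C (f (h + z0)%C))
        by (do 2 f_equal; ring).
      assert (Eh : (h + z0 - z0)%C = h) by ring.
      apply Ha; rewrite ?Eh.
      + apply (in_disk_near z0); auto. rewrite Eh. eapply Rlt_le_trans; [apply Hh|apply Rmin_r].
      + eapply Rlt_le_trans; [apply Hh|apply Rmin_l].
    - assert (K : cderiv f z D).
      { apply (has_deriv_ext_loc _ (fun w => f ((w + - z0) + z0)%C) _ _ _ 1); [lra|intros; f_equal; ring|].
        eapply has_deriv_eq.
        - apply (has_deriv_comp _ (fun h => f (h + z0)%C)); [apply H1|].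
          apply has_deriv_plus; [apply has_deriv_id|apply has_deriv_const].
        - ring. }
      rewrite (cderiv_C_derive _ _ _ K). auto. }
  split.
  - intros z Hz. destruct (L z Hz) as (a & r & Hr & Ha). apply (Ha z).
    replace (z - z)%C with (RtoC 0) by ring. rewrite Cmod_0; auto.
  - intros z0 Hz0. destruct (L z0 Hz0) as (a & r & Hr & Ha). exists a, r. split; auto.
    intros z _ Hz. apply (Ha z Hz).
Qed.

Lemma analytic_cderiv (f : C -> C) z : analytic_on_disk f -> in_disk z -> cderiv f z (C_derive f z).
Proof. intros H. apply analytic_derivable, H. Qed.

Lemma analytic_C_derive (f : C -> C) : analytic_on_disk f -> analytic_on_disk (C_derive f).
Proof. intros H. apply analytic_derivable, H. Qed.

Lemma analytic_ccont (f : C -> C) z : analytic_on_disk f -> in_disk z -> ccont f z.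
Proof. intros H Hz. eapply has_deriv_cont, analytic_cderiv; eauto. Qed.

Lemma in_disk_0 : in_disk 0.
Proof. unfold in_disk. rewrite Cmod_0. lra. Qed.

(** Differentiating the radial integral under the integral sign only gives derivatives with respect
    to a real parameter, that is along lines z + s h ([Line]). The mean value theorem and the
    continuity of g then upgrade these to a complex derivative. *)
Lemma primitive_on_disk (g : C -> C) : analytic_on_disk g ->
  exists P : C -> C, P 0 = 0 /\ forall z, in_disk z -> cderiv P z (g z).
Proof.
  intros Hg. exists (fun z => cint (fun t => z * g (RtoC t * z))%C 0 1). split.
  { rewrite (cint_ext 0 1 ltac:(lra) _ (fun _ => RtoC 0)) by (intros; ring).
    rewrite cint_const. ring. }
  intros z Hz.
  assert (Line : forall h s, in_disk (z + RtoC s * h) ->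
    rderiv (fun s => cint (fun t => (z + RtoC s * h) * g (RtoC t * (z + RtoC s * h)))%C 0 1) s
      (h * g (z + RtoC s * h))%C).
  { intros h s Hs. unfold in_disk in Hs.
    set (m := Cmod (z + RtoC s * h)) in *.
    assert (m0 : 0 <= m) by apply Cmod_ge_0. pose proof (Cmod_ge_0 h) as h0.
    (* Moving s by e and letting t reach 1 + e each cost at most (1 - m) / 4 in modulus, so t (z + s
       h) stays in the disk. *)
    set (e := Rmin (1/2) ((1 - m) / (4 * (1 + Cmod h)))).
    assert (E : 0 < e) by (apply Rmin_glb_lt; [lra|apply Rdiv_lt_0_compat; lra]).
    assert (E1 : e <= 1/2) by apply Rmin_l.
    assert (E2 : e * (1 + Cmod h) <= (1 - m) / 4).
    { apply Rle_trans with ((1 - m) / (4 * (1 + Cmod h)) * (1 + Cmod h)); [|right; field; lra].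
      apply Rmult_le_compat_r; [lra|apply Rmin_r]. }
    assert (Dk : forall s' t, Rabs (s' - s) < e -> 0 - e < t < 1 + e -> in_disk (RtoC t * (z + RtoC s' * h))).
    { intros s' t Hs' Ht. unfold in_disk.
      replace (z + RtoC s' * h)%C with ((z + RtoC s * h) + RtoC (s' - s) * h)%C by (rewrite RtoC_minus; ring).
      rewrite Cmod_mult, Cmod_R.
      pose proof (Cmod_triangle (z + RtoC s * h) (RtoC (s' - s) * h)) as Tr.
      rewrite Cmod_mult, Cmod_R in Tr. fold m in Tr.
      pose proof (Cmod_ge_0 (z + RtoC s * h + RtoC (s' - s) * h)).
      assert (Rabs (s' - s) * Cmod h <= e * Cmod h) by (apply Rmult_le_compat_r; lra).
      set (X := Cmod (z + RtoC s * h + RtoC (s' - s) * h)) in *.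
      assert (XB : X <= m + (1 - m) / 4) by nra.
      assert (e <= (1 - m) / 4) by nra.
      assert (Rabs t <= 1 + e) by (apply Rabs_le; lra).
      assert (Rabs t * X <= (1 + e) * X) by (apply Rmult_le_compat_r; auto).
      nra. }
    assert (Kr : forall s' t, Rabs (s' - s) < e -> 0 <= t <= 1 -> rcont (fun t => (z + RtoC s' * h) * g (RtoC t * (z + RtoC s' * h)))%C t).
    { intros s' t Hs' Ht. apply cont_mult; [apply cont_const|].
      apply (cont_comp _ g); [apply analytic_ccont; auto; apply Dk; lra|].
      apply cont_mult; [apply cont_id|apply cont_const]. }
    assert (S0 : Rabs (s - s) < e) by (rewrite Rminus_diag, Rabs_R0; auto).
    assert (Cid : forall p : C, ccont (fun p : C => z + RtoC (Re p) * h)%C p).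
    { intros p. apply cont_plus; [apply cont_const|]. apply cont_mult; [apply cont_RtoC_Re, cont_id|apply cont_const]. }
    assert (Cip : forall p : C, ccont (fun p : C => RtoC (Im p) * (z + RtoC (Re p) * h))%C p).
    { intros p. apply cont_mult; [apply cont_RtoC_Im, cont_id|apply Cid]. }
    pose proof (cint_param 0 1 ltac:(lra)
      (fun s t => (z + RtoC s * h) * g (RtoC t * (z + RtoC s * h)))%C
      (fun s t => h * g (RtoC t * (z + RtoC s * h)) +
         (z + RtoC s * h) * (C_derive g (RtoC t * (z + RtoC s * h)) * (RtoC t * h)))%C s e E) as H.
    eapply has_deriv_eq; [apply H|]; clear H.
    - intros s' t Hs' Ht. eapply has_deriv_eq.
      + apply has_deriv_mult.
        * apply has_deriv_plus; [apply has_deriv_const|]. apply has_deriv_mult; [apply has_deriv_id|apply has_deriv_const].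
        * apply (has_deriv_comp RtoC g); [apply analytic_cderiv; auto|].
          apply has_deriv_mult; [apply has_deriv_const|].
          apply has_deriv_plus; [apply has_deriv_const|]. apply has_deriv_mult; [apply has_deriv_id|apply has_deriv_const].
      + cbv beta. ring.
    - intros t Ht. apply cont_plus; apply cont_mult; auto.
      + apply cont_const.
      + apply (cont_comp _ g); auto. apply analytic_ccont; auto. apply (Dk s t); auto; lra.
      + apply cont_mult.
        * apply (cont_comp _ (C_derive g)); auto. apply analytic_ccont; [apply analytic_C_derive; auto|].
          apply (Dk s t); auto; lra.
        * apply cont_mult; [apply cont_RtoC_Im, cont_id|apply cont_const].
    - auto.
    (* The s-derivative of the integrand coincides with the t-derivative of h t g(t w), so its
       integral over [0, 1] is h g(w). *)
    - set (w := (z + RtoC s * h)%C) in *.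
      rewrite (cint_FTC 0 1 ltac:(lra) (fun t => h * (RtoC t * g (RtoC t * w)))%C).
      + replace (RtoC 1 * w)%C with w by ring. ring.
      + intros t Ht. eapply has_deriv_eq.
        * apply has_deriv_mult; [apply has_deriv_const|]. apply has_deriv_mult; [apply has_deriv_id|].
          apply (has_deriv_comp RtoC g); [apply analytic_cderiv; auto; apply (Dk s t); auto; lra|].
          apply has_deriv_mult; [apply has_deriv_id|apply has_deriv_const].
        * cbv beta. ring.
      + intros t Ht.
        assert (In : in_disk (RtoC t * w)) by (apply (Dk s t); auto; lra).
        assert (rcont (fun t => RtoC t * w)%C t) by (apply cont_mult; [apply cont_id|apply cont_const]).
        apply cont_plus; apply cont_mult; try apply cont_const.
        * apply (cont_comp _ g); auto. apply analytic_ccont; auto.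
        * apply cont_mult.
          -- apply (cont_comp _ (C_derive g)); auto. apply analytic_ccont; auto. apply analytic_C_derive; auto.
          -- apply cont_mult; [apply cont_id|apply cont_const]. }
  set (P := fun z => cint (fun t => z * g (RtoC t * z))%C 0 1) in *.
  intros eps He. destruct (analytic_ccont g z Hg Hz (eps / 2) ltac:(lra)) as [d [Hd G]].
  exists (Rmin d (1 - Cmod z)). split; [unfold in_disk in Hz; apply Rmin_glb_lt; lra|].
  intros w Hw. set (h := (w - z)%C) in *. pose proof (Cmod_ge_0 h) as h0.
  pose proof (Rmin_l d (1 - Cmod z)). pose proof (Rmin_r d (1 - Cmod z)).
  assert (Sm : forall s, 0 <= s <= 1 -> Cmod (z + RtoC s * h - z) < Rmin d (1 - Cmod z)).
  { intros s Hs. replace (z + RtoC s * h - z)%C with (RtoC s * h)%C by ring.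
    rewrite Cmod_mult, Cmod_R, Rabs_pos_eq by lra. nra. }
  (* Subtracting the linear part leaves the derivative h (g (z + s h) - g z), which is small by
     continuity of g. Real and imaginary parts each receive eps / 2. *)
  assert (DL : forall s, 0 <= s <= 1 ->
    rderiv (fun s => P (z + RtoC s * h)%C + RtoC s * (- (g z * h)))%C s (h * (g (z + RtoC s * h) - g z))%C).
  { intros s Hs. eapply has_deriv_eq.
    - apply has_deriv_plus; [apply Line|].
      + apply (in_disk_near z); auto. specialize (Sm s Hs). lra.
      + apply has_deriv_mult; [apply has_deriv_id|apply has_deriv_const].
    - cbv beta. ring. }
  assert (BD : forall s, 0 <= s <= 1 -> Cmod (h * (g (z + RtoC s * h) - g z))%C <= eps / 2 * Cmod h).
  { intros s Hs. rewrite Cmod_mult, Rmult_comm. apply Rmult_le_compat_r; auto.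
    left. apply G. specialize (Sm s Hs). lra. }
  set (u := fun s => (P (z + RtoC s * h) + RtoC s * (- (g z * h)))%C) in *.
  replace (P w - P z - g z * h)%C with (u 1 - u 0)%C.
  2:{ unfold u. replace (z + RtoC 1 * h)%C with w by (unfold h; ring).
      replace (z + RtoC 0 * h)%C with z by ring. ring. }
  eapply Rle_trans; [apply Cmod_le_Re_Im|].
  assert (M1 : Rabs (Re (u 1 - u 0)) <= eps / 2 * Cmod h).
  { destruct (MVT_gen (fun s => Re (u s)) 0 1 (fun s => Re (h * (g (z + RtoC s * h) - g z)))%C) as [c [Hc Ec]].
    - intros s Hs. rewrite Rmin_left, Rmax_right in Hs by lra. apply rderiv_Re, DL. lra.
    - intros s Hs. rewrite Rmin_left, Rmax_right in Hs by lra.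
      apply continuity_pt_filterlim, rcont_Re. eapply has_deriv_cont, DL. lra.
    - rewrite Rmin_left, Rmax_right in Hc by lra.
      change (Re (u 1 - u 0)%C) with (Re (u 1) - Re (u 0)). rewrite Ec, Rminus_0_r, Rmult_1_r.
      eapply Rle_trans; [apply re_le_Cmod|]. apply BD; auto. }
  assert (M2 : Rabs (Im (u 1 - u 0)) <= eps / 2 * Cmod h).
  { destruct (MVT_gen (fun s => Im (u s)) 0 1 (fun s => Im (h * (g (z + RtoC s * h) - g z)))%C) as [c [Hc Ec]].
    - intros s Hs. rewrite Rmin_left, Rmax_right in Hs by lra. apply rderiv_Im, DL. lra.
    - intros s Hs. rewrite Rmin_left, Rmax_right in Hs by lra.
      apply continuity_pt_filterlim, rcont_Im. eapply has_deriv_cont, DL. lra.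
    - rewrite Rmin_left, Rmax_right in Hc by lra.
      change (Im (u 1 - u 0)%C) with (Im (u 1) - Im (u 0)). rewrite Ec, Rminus_0_r, Rmult_1_r.
      eapply Rle_trans; [apply im_le_Cmod|]. apply BD; auto. }
  lra.
Qed.

(** * Extreme values and the maximum principle *)

Section Extreme_value.
Variable r : R.

Lemma closed_disk_bounded (u : C -> R) :
  (forall z, Cmod z <= r -> ccont (fun z => RtoC (u z)) z) ->
  exists B, forall z, Cmod z <= r -> u z <= B.
Proof.
  intros Hu.
  (* The gauge itself carries the bound: d |u| <= 1 at its centre, so the uniform lower bound on
     gauges supplied by [compactness_value_2d] bounds u at the centres by its inverse. Centres
     outside the disk get a gauge that keeps them away from it. The factor 2 compares squares with
     disks. *)
  assert (Spec : forall x y, exists d : posreal,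
    (Cmod (x, y) <= r -> d * Rabs (u (x, y)) <= 1 /\ forall w, Cmod (w - (x, y)) < 2 * d -> u w <= u (x, y) + 1) /\
    (r < Cmod (x, y) -> forall w, Cmod (w - (x, y)) < 2 * d -> r < Cmod w)).
  { intros x y. destruct (Rle_lt_dec (Cmod (x, y)) r) as [Hr|Hr].
    - destruct (Hu _ Hr 1 Rlt_0_1) as [d [Hd F]].
      pose proof (Rabs_pos (u (x, y))) as A0.
      assert (P : 0 < Rmin (d / 2) (/ (1 + Rabs (u (x, y))))).
      { apply Rmin_glb_lt; [lra|]. apply Rinv_0_lt_compat. lra. }
      pose proof (Rmin_l (d / 2) (/ (1 + Rabs (u (x, y))))).
      pose proof (Rmin_r (d / 2) (/ (1 + Rabs (u (x, y))))).
      exists (mkposreal _ P). simpl. split; [intros _; split|intros; lra].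
      + apply Rle_trans with (/ (1 + Rabs (u (x, y))) * (1 + Rabs (u (x, y)))); [|right; field; lra].
        apply Rmult_le_compat; lra.
      + intros w Hw. specialize (F w ltac:(lra)). rewrite <- RtoC_minus, Cmod_R in F.
        apply Rabs_def2 in F. lra.
    - assert (P : 0 < (Cmod (x, y) - r) / 2) by lra.
      exists (mkposreal _ P). simpl. split; [intros; lra|]. intros _ w Hw.
      pose proof (Cmod_sub_ge (x, y) w). rewrite Cmod_sub_sym in Hw. lra. }
  set (D := fun x y => proj1_sig (constructive_indefinite_description _ (Spec x y))).
  assert (HD : forall x y,
    (Cmod (x, y) <= r -> D x y * Rabs (u (x, y)) <= 1 /\ forall w, Cmod (w - (x, y)) < 2 * D x y -> u w <= u (x, y) + 1) /\
    (r < Cmod (x, y) -> forall w, Cmod (w - (x, y)) < 2 * D x y -> r < Cmod w)).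
  { intros x y. unfold D. apply (proj2_sig (constructive_indefinite_description _ (Spec x y))). }
  destruct (compactness_value_2d (- r) r (- r) r D) as [d Hd].
  exists (/ d + 1). intros [x y] Hz. apply Rnot_lt_le. intros Hlt.
  pose proof (cond_pos d) as d0.
  pose proof (re_le_Cmod (x, y)) as Bx. pose proof (im_le_Cmod (x, y)) as By. simpl in Bx, By.
  apply (Hd x y).
  - apply Rabs_le_between. lra.
  - apply Rabs_le_between. lra.
  - intros (p & q & _ & _ & Hp & Hq & Hdd).
    assert (W : Cmod ((x, y) - (p, q)) < 2 * D p q).
    { eapply Rle_lt_trans; [apply Cmod_le_Re_Im|]. simpl. unfold Rminus in *. lra. }
    destruct (Rle_lt_dec (Cmod (p, q)) r) as [Hr|Hr].
    + destruct (proj1 (HD p q) Hr) as [H1 H2]. specialize (H2 (x, y) W).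
      pose proof (Rle_abs (u (p, q))). pose proof (Rabs_pos (u (p, q))).
      assert (Rabs (u (p, q)) <= / d).
      { apply Rmult_le_reg_l with d; auto. rewrite Rinv_r by lra.
        eapply Rle_trans; [|apply H1]. apply Rmult_le_compat_r; auto. }
      lra.
    + pose proof (proj2 (HD p q) Hr (x, y) W). lra.
Qed.

(** If the supremum M were not attained, 1 / (M - u) would be continuous, hence bounded by some K,
    and u <= M - 1 / K would contradict the choice of M. *)
Lemma closed_disk_max (u : C -> R) : 0 <= r ->
  (forall z, Cmod z <= r -> ccont (fun z => RtoC (u z)) z) ->
  exists z0, Cmod z0 <= r /\ forall z, Cmod z <= r -> u z <= u z0.
Proof.
  intros Hr Hu. destruct (closed_disk_bounded u Hu) as [B HB].
  destruct (completeness (fun y => exists z, Cmod z <= r /\ y = u z)) as [M [HM1 HM2]].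
  { exists B. intros y (z & Hz & ->). auto. }
  { exists (u 0), (RtoC 0). rewrite Cmod_0. auto. }
  apply NNPP. intros Hno.
  assert (Hlt : forall z, Cmod z <= r -> u z < M).
  { intros z Hz. destruct (Rle_lt_or_eq_dec (u z) M) as [|E]; auto.
    - apply HM1. exists z; auto.
    - exfalso. apply Hno. exists z. split; auto. intros z' Hz'. rewrite E. apply HM1. exists z'; auto. }
  destruct (closed_disk_bounded (fun z => / (M - u z))) as [K HK].
  { intros z Hz. specialize (Hlt z Hz).
    destruct (Hu z Hz ((M - u z) / 2) ltac:(lra)) as [e [He F]].
    apply (cont_ext_loc _ (fun z => / (RtoC M + - (1) * RtoC (u z)))%C _ _ e); auto.
    - intros s Hs. specialize (F s Hs). rewrite <- RtoC_minus, Cmod_R in F. apply Rabs_def2 in F.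
      rewrite RtoC_inv by lra. f_equal. rewrite RtoC_minus. ring.
    - apply cont_inv.
      + replace (RtoC M + - (1) * RtoC (u z))%C with (RtoC (M - u z)) by (rewrite RtoC_minus; ring).
        intros E. apply RtoC_inj in E. lra.
      + apply cont_plus; [apply cont_const|]. apply cont_mult; [apply cont_const|auto]. }
  assert (K0 : 0 < K).
  { pose proof (HK 0) as H0. rewrite Cmod_0 in H0. specialize (H0 Hr).
    assert (0 < / (M - u 0)); [|lra]. apply Rinv_0_lt_compat.
    specialize (Hlt 0). rewrite Cmod_0 in Hlt. specialize (Hlt Hr). lra. }
  assert (M <= M - / K); [|pose proof (Rinv_0_lt_compat K K0); lra].
  apply HM2. intros y (z & Hz & ->). specialize (HK z Hz). specialize (Hlt z Hz).
  apply Rinv_le_contravar in HK; [|apply Rinv_0_lt_compat; lra]. rewrite Rinv_inv in HK. lra.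
Qed.

End Extreme_value.

(** * Derivative tests at a maximum *)

Lemma fermat_max (q : R -> R) (d e : R) : 0 < e -> is_derive q 0 d ->
  (forall t, Rabs t < e -> q t <= q 0) -> d = 0.
Proof.
  intros He Hd Hq. destruct (Req_dec d 0) as [|Hn]; auto. exfalso.
  assert (P : 0 < Rabs d) by (apply Rabs_pos_lt; auto).
  destruct (proj1 (is_derive_eps _ _ _) Hd (Rabs d / 2) ltac:(lra)) as [e1 [H1 F]].
  set (t := Rmin e e1 / 2).
  assert (T : 0 < t < Rmin e e1).
  { assert (0 < Rmin e e1) by (apply Rmin_glb_lt; auto). unfold t. lra. }
  pose proof (Rmin_l e e1). pose proof (Rmin_r e e1).
  destruct (Rcase_abs d) as [D|D].
  - specialize (F (- t)). rewrite Rminus_0_r, Rabs_Ropp, (Rabs_pos_eq t) in F by lra.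
    specialize (F ltac:(lra)). specialize (Hq (- t)). rewrite Rabs_Ropp, Rabs_pos_eq in Hq by lra.
    specialize (Hq ltac:(lra)). rewrite (Rabs_left d) in F by lra. apply Rabs_le_between in F. nra.
  - specialize (F t). rewrite Rminus_0_r, (Rabs_pos_eq t) in F by lra.
    specialize (F ltac:(lra)). specialize (Hq t). rewrite Rabs_pos_eq in Hq by lra.
    specialize (Hq ltac:(lra)). rewrite (Rabs_right d) in F by lra. apply Rabs_le_between in F.
    assert (d <> 0) by auto. nra.
Qed.

Lemma second_deriv_max (q q' : R -> R) (l e : R) : 0 < e ->
  (forall t, Rabs t < e -> is_derive q t (q' t)) -> is_derive q' 0 l ->
  (forall t, Rabs t < e -> q t <= q 0) -> l <= 0.
Proof.
  intros He Hd Hl Hq. apply Rnot_lt_le. intros L.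
  assert (Q0 : q' 0 = 0).
  { apply (fermat_max q _ e); auto. apply Hd. rewrite Rabs_R0; auto. }
  destruct (proj1 (is_derive_eps _ _ _) Hl (l / 2) ltac:(lra)) as [e1 [H1 F]].
  set (t := Rmin e e1 / 2).
  assert (T : 0 < t < Rmin e e1).
  { assert (0 < Rmin e e1) by (apply Rmin_glb_lt; auto). unfold t. lra. }
  pose proof (Rmin_l e e1). pose proof (Rmin_r e e1).
  destruct (MVT_cor2 q q' 0 t) as [c [Hc1 Hc2]]; [lra| |].
  { intros c Hc. apply is_derive_Reals, Hd. rewrite Rabs_pos_eq; lra. }
  specialize (F c). rewrite Rminus_0_r, (Rabs_pos_eq c), Q0, Rminus_0_r in F by lra.
  specialize (F ltac:(lra)). apply Rabs_le_between in F.
  specialize (Hq t). rewrite Rabs_pos_eq in Hq by lra. specialize (Hq ltac:(lra)).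
  assert (0 < l * c) by (apply Rmult_lt_0_compat; lra).
  assert (0 < q' c * (t - 0)) by (apply Rmult_lt_0_compat; lra). lra.
Qed.

Section Second_derivative.
Variable e : R.
Hypothesis e_pos : 0 < e.

Definition twice_derivable (q q' : R -> R) (l : R) : Prop :=
  (forall t, Rabs t < e -> is_derive q t (q' t)) /\ is_derive q' 0 l.

Lemma twice_derivable_plus p p' k q q' l : twice_derivable p p' k -> twice_derivable q q' l ->
  twice_derivable (fun t => p t + q t) (fun t => p' t + q' t) (k + l).
Proof.
  intros [H1 H2] [H3 H4]. split; intros; apply (is_derive_plus (V := R_NormedModule)); auto.
Qed.

Lemma twice_derivable_scal c q q' l : twice_derivable q q' l ->
  twice_derivable (fun t => c * q t) (fun t => c * q' t) (c * l).
Proof. intros [H1 H2]. split; intros; apply is_derive_scal; auto. Qed.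

Lemma is_derive_Rmult (f g : R -> R) t a b : is_derive f t a -> is_derive g t b ->
  is_derive (fun s => f s * g s) t (a * g t + f t * b).
Proof. intros Ha Hb. apply (is_derive_mult f g t a b Ha Hb). intros; apply Rmult_comm. Qed.

Lemma twice_derivable_sqr q q' l : twice_derivable q q' l ->
  twice_derivable (fun t => q t * q t) (fun t => q' t * q t + q t * q' t)
    (2 * (q' 0 * q' 0 + q 0 * l)).
Proof.
  intros [H1 H2].
  assert (H0 : is_derive q 0 (q' 0)) by (apply H1; rewrite Rabs_R0; auto).
  split; [intros; apply is_derive_Rmult; auto|].
  replace (2 * (q' 0 * q' 0 + q 0 * l)) with ((l * q 0 + q' 0 * q' 0) + (q' 0 * q' 0 + q 0 * l)) by ring.
  apply (is_derive_plus (V := R_NormedModule)); apply is_derive_Rmult; auto.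
Qed.

End Second_derivative.

Lemma rderiv_line (z h : C) t : rderiv (fun t => z + RtoC t * h)%C t h.
Proof.
  eapply has_deriv_eq.
  - apply has_deriv_plus; [apply has_deriv_const|].
    apply has_deriv_mult; [apply has_deriv_id|apply has_deriv_const].
  - cbv beta. ring.
Qed.

(** The left-hand side is half the second derivative at t = 0 of |k|^2 + eps |z|^2 along the line
    through z with direction h. *)
Lemma line_second_deriv (k : C -> C) (z h : C) (eps e : R) : analytic_on_disk k -> 0 < e ->
  (forall t, Rabs t < e -> in_disk (z + RtoC t * h)) ->
  (forall t, Rabs t < e -> Cmod (k (z + RtoC t * h)%C) ^ 2 + eps * Cmod (z + RtoC t * h) ^ 2 <=
     Cmod (k z) ^ 2 + eps * Cmod z ^ 2) ->
  Cmod (C_derive k z * h) ^ 2 + Re (C_derive (C_derive k) z * (h * h) * Cconj (k z)) + eps * Cmod h ^ 2 <= 0.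
Proof.
  intros Hk He Hin Hmax.
  set (l := fun t : R => (z + RtoC t * h)%C).
  set (g := fun t : R => k (l t)). set (g' := fun t : R => (C_derive k (l t) * h)%C).
  set (g2 := (C_derive (C_derive k) z * (h * h))%C).
  assert (l0 : l 0 = z) by (unfold l; ring).
  assert (Dg : forall t, Rabs t < e -> rderiv g t (g' t)).
  { intros t Ht. apply (has_deriv_comp RtoC k); [apply analytic_cderiv; auto; apply Hin, Ht|apply rderiv_line]. }
  assert (Dg' : rderiv g' 0 g2).
  { eapply has_deriv_eq.
    - apply has_deriv_mult; [|apply has_deriv_const].
      apply (has_deriv_comp RtoC (C_derive k)).
      + apply analytic_cderiv; [apply analytic_C_derive; auto|]. apply Hin. rewrite Rabs_R0; auto.
      + apply rderiv_line.
    - cbv beta. change (z + RtoC 0 * h)%C with (l 0). rewrite l0. unfold g2. ring. }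
  assert (D1 : twice_derivable e (fun t => Re (g t)) (fun t => Re (g' t)) (Re g2)).
  { split; [intros; apply rderiv_Re; auto|apply rderiv_Re; auto]. }
  assert (D2 : twice_derivable e (fun t => Im (g t)) (fun t => Im (g' t)) (Im g2)).
  { split; [intros; apply rderiv_Im; auto|apply rderiv_Im; auto]. }
  assert (D3 : twice_derivable e (fun t => Re (l t)) (fun t => Re h) 0).
  { split; [intros; apply rderiv_Re, rderiv_line|apply (is_derive_const (V := R_NormedModule))]. }
  assert (D4 : twice_derivable e (fun t => Im (l t)) (fun t => Im h) 0).
  { split; [intros; apply rderiv_Im, rderiv_line|apply (is_derive_const (V := R_NormedModule))]. }
  pose proof (twice_derivable_plus _ _ _ _ _ _ _
    (twice_derivable_plus _ _ _ _ _ _ _ (twice_derivable_sqr e He _ _ _ D1) (twice_derivable_sqr e He _ _ _ D2))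
    (twice_derivable_scal _ eps _ _ _
      (twice_derivable_plus _ _ _ _ _ _ _ (twice_derivable_sqr e He _ _ _ D3) (twice_derivable_sqr e He _ _ _ D4)))) as [E1 E2].
  pose proof (second_deriv_max _ _ _ e He E1 E2) as T. cbv beta in T.
  replace (g' 0) with (C_derive k z * h)%C in T by (unfold g'; rewrite l0; reflexivity).
  replace (g 0) with (k z) in T by (unfold g; rewrite l0; reflexivity).
  assert (Re (g2 * Cconj (k z)) = Re (k z) * Re g2 + Im (k z) * Im g2) as ->.
  { rewrite (re_mult _ (Cconj (k z))), re_conj, im_conj. ring. }
  rewrite !Cmod2_alt.
  cut (2 * (Re (C_derive k z * h) ^ 2 + Im (C_derive k z * h) ^ 2 +
     (Re (k z) * Re g2 + Im (k z) * Im g2) + eps * (Re h ^ 2 + Im h ^ 2)) <= 0); [lra|].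
  eapply Rle_trans; [|apply T].
  - right. ring.
  - intros t Ht. specialize (Hmax t Ht). rewrite !Cmod2_alt in Hmax.
    rewrite l0. change (k (z + RtoC t * h)%C) with (g t) in Hmax.
    change (z + RtoC t * h)%C with (l t) in Hmax. lra.
Qed.

Lemma max_modulus (k : C -> C) (r M : R) : analytic_on_disk k -> 0 <= r < 1 ->
  (forall z, Cmod z = r -> Cmod (k z) <= M) -> forall z, Cmod z <= r -> Cmod (k z) <= M.
Proof.
  intros Hk Hr HM z Hz.
  assert (M0 : 0 <= M).
  { eapply Rle_trans; [apply Cmod_ge_0|apply (HM (RtoC r))]. rewrite Cmod_R, Rabs_pos_eq; lra. }
  assert (Q : forall eps, 0 < eps -> Cmod (k z) ^ 2 <= M ^ 2 + eps).
  { intros eps He.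
    destruct (closed_disk_max r (fun z => Cmod (k z) ^ 2 + eps * Cmod z ^ 2)) as [z0 [H0 H1]]; [lra| |].
    { intros w Hw.
      assert (Sq : forall f : C -> C, ccont f w -> ccont (fun z => RtoC (Cmod (f z) ^ 2)) w).
      { intros f Hf. apply (cont_ext_loc _ (fun z => RtoC (Re (f z)) * RtoC (Re (f z)) + RtoC (Im (f z)) * RtoC (Im (f z)))%C _ _ 1); [lra| |].
        - intros s _. rewrite Cmod2_alt, <- !RtoC_mult, <- RtoC_plus. f_equal. ring.
        - apply cont_plus; apply cont_mult; (apply cont_RtoC_Re || apply cont_RtoC_Im); auto. }
      apply (cont_ext_loc _ (fun z => RtoC (Cmod (k z) ^ 2) + RtoC eps * RtoC (Cmod z ^ 2))%C _ _ 1); [lra| |].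
      - intros s _. rewrite RtoC_plus, RtoC_mult. reflexivity.
      - apply cont_plus; [|apply cont_mult; [apply cont_const|]].
        + apply Sq, analytic_ccont; auto. unfold in_disk; lra.
        + apply (Sq (fun z => z)), cont_id. }
    destruct (Rle_lt_or_eq_dec _ _ H0) as [Hlt|Heq].
    - exfalso.
      assert (Hin : forall h t, Cmod h = 1 -> Rabs t < r - Cmod z0 -> Cmod (z0 + RtoC t * h) <= r).
      { intros h t Hh Ht. eapply Rle_trans; [apply Cmod_triangle|]. rewrite Cmod_mult, Cmod_R, Hh. lra. }
      assert (L : forall h, Cmod h = 1 ->
        Cmod (C_derive k z0 * h) ^ 2 + Re (C_derive (C_derive k) z0 * (h * h) * Cconj (k z0)) + eps * Cmod h ^ 2 <= 0).
      { intros h Hh. apply (line_second_deriv k z0 h eps (r - Cmod z0)); [exact Hk|lra| |].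
        - intros t Ht. specialize (Hin h t Hh Ht). unfold in_disk. lra.
        - intros t Ht. apply H1. auto. }
      (* The squares of the directions 1 and i are opposite, so adding the two inequalities cancels
         the terms with k'' and leaves 2 |k'|^2 + 2 eps <= 0. *)
      pose proof (L 1 Cmod_1) as L1. pose proof (L Ci Cmod_Ci) as L2.
      rewrite Cmod_1 in L1. rewrite Cmod_Ci in L2.
      replace (C_derive (C_derive k) z0 * (Ci * Ci) * Cconj (k z0))%C with
        (- (C_derive (C_derive k) z0 * (1 * 1) * Cconj (k z0)))%C in L2.
      2:{ replace (Ci * Ci)%C with (- (1))%C by (apply Ceq; unfold Re, Im; simpl; ring). ring. }
      rewrite re_opp in L2.
      pose proof (pow_le _ 2 (Cmod_ge_0 (C_derive k z0 * 1))).
      pose proof (pow_le _ 2 (Cmod_ge_0 (C_derive k z0 * Ci))). lra.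
    - specialize (H1 z Hz). specialize (HM z0 Heq).
      assert (Cmod (k z0) ^ 2 <= M ^ 2) by (apply pow_incr; split; auto; apply Cmod_ge_0).
      assert (0 <= Cmod z ^ 2) by apply pow_le, Cmod_ge_0.
      rewrite Heq in H1. assert (r ^ 2 <= 1) by (simpl; nra). nra. }
  apply Rsqr_incr_0_var; auto. rewrite !Rsqr_pow2. apply le_epsilon, Q.
Qed.

(** * Closure properties of analytic functions *)

Lemma analytic_const (c : C) : analytic_on_disk (fun _ => c).
Proof.
  apply (C1_analytic _ (fun _ => RtoC 0)); intros; [apply has_deriv_const|apply cont_const].
Qed.

Lemma analytic_id : analytic_on_disk (fun z => z).
Proof.
  apply (C1_analytic _ (fun _ => RtoC 1)); intros; [apply has_deriv_id|apply cont_const].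
Qed.

Lemma analytic_plus (f g : C -> C) : analytic_on_disk f -> analytic_on_disk g ->
  analytic_on_disk (fun z => f z + g z)%C.
Proof.
  intros Hf Hg. apply (C1_analytic _ (fun z => C_derive f z + C_derive g z)%C); intros z Hz.
  - apply has_deriv_plus; apply analytic_cderiv; auto.
  - apply cont_plus; apply analytic_ccont; auto using analytic_C_derive.
Qed.

Lemma analytic_mult (f g : C -> C) : analytic_on_disk f -> analytic_on_disk g ->
  analytic_on_disk (fun z => f z * g z)%C.
Proof.
  intros Hf Hg. apply (C1_analytic _ (fun z => C_derive f z * g z + f z * C_derive g z)%C); intros z Hz.
  - apply has_deriv_mult; apply analytic_cderiv; auto.
  - apply cont_plus; apply cont_mult; apply analytic_ccont; auto using analytic_C_derive.
Qed.

Lemma analytic_inv (f : C -> C) : analytic_on_disk f -> (forall z, in_disk z -> f z <> 0) ->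
  analytic_on_disk (fun z => / f z)%C.
Proof.
  intros Hf H0. apply (C1_analytic _ (fun z => - (1) * / (f z * f z) * C_derive f z)%C); intros z Hz.
  - eapply has_deriv_eq; [apply has_deriv_inv; [apply H0, Hz|apply analytic_cderiv; auto]|]. ring.
  - apply cont_mult; [apply cont_mult; [apply cont_const|]|apply analytic_ccont; auto using analytic_C_derive].
    apply cont_inv; [apply Cmult_neq_0; auto|]. apply cont_mult; apply analytic_ccont; auto.
Qed.

Lemma analytic_comp (f g : C -> C) : analytic_on_disk f -> analytic_on_disk g ->
  (forall z, in_disk z -> in_disk (g z)) -> analytic_on_disk (fun z => f (g z)).
Proof.
  intros Hf Hg Hin. apply (C1_analytic _ (fun z => C_derive f (g z) * C_derive g z)%C); intros z Hz.
  - apply (has_deriv_comp _ f); apply analytic_cderiv; auto.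
  - apply cont_mult; [apply (cont_comp _ (C_derive f))|]; apply analytic_ccont; auto using analytic_C_derive.
Qed.

(** * Division by z, the Schwarz lemma and the Schwarz-Pick inequality at 0 *)

Lemma psum_shift (a : nat -> C) (z : C) n : psum a z (S n) = (a O + z * psum (fun k => a (S k)) z n)%C.
Proof.
  induction n as [|n IH]; [simpl; ring|].
  change (psum a z (S (S n))) with (psum a z (S n) + z ^ S n * a (S n))%C. rewrite IH. simpl. ring.
Qed.

Lemma pseries_shift (a : nat -> C) (z l : C) : z <> 0 ->
  is_pseries (K := C_AbsRing) (V := C_NormedModule) a z l ->
  is_pseries (K := C_AbsRing) (V := C_NormedModule) (fun k => a (S k)) z ((l - a O) / z)%C.
Proof.
  intros Hz H. rewrite is_pseries_psum in *. pose proof (proj1 (Cmod_gt_0 z) Hz) as Pz.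
  intros eps He. destruct (H (eps * Cmod z)) as [N HN]; [apply Rmult_lt_0_compat; auto|].
  exists N. intros n Hn. specialize (HN (S n) ltac:(lia)). rewrite psum_shift in HN.
  apply Rmult_lt_reg_r with (Cmod z); auto. rewrite <- Cmod_mult.
  replace ((psum (fun k => a (S k)) z n - (l - a O) / z) * z)%C with
    (a O + z * psum (fun k => a (S k)) z n - l)%C by (field; auto). exact HN.
Qed.

Lemma pseries_0 (a : nat -> C) : is_pseries (K := C_AbsRing) (V := C_NormedModule) a (RtoC 0) (a O).
Proof.
  apply is_pseries_psum. intros eps He. exists 1%nat. intros n Hn.
  destruct n as [|n]; [lia|]. rewrite psum_shift.
  replace (a O + 0 * psum (fun k => a (S k)) 0 n - a O)%C with (RtoC 0) by ring. rewrite Cmod_0. auto.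
Qed.

(** The quotient (f z - f 0) / z with its singularity at 0 removed: the shifted coefficients of f
    give its power series there. The final identity is pure algebra and so holds for every z, also
    outside the disk. *)
Lemma divided_difference (f : C -> C) : analytic_on_disk f ->
  exists h, analytic_on_disk h /\ h 0 = C_derive f 0 /\ forall z, f z = (f 0 + z * h z)%C.
Proof.
  intros Hf.
  exists (fun z => if Ceq_dec z 0 then C_derive f 0 else (f z - f 0) / z)%C.
  split; [|split].
  - apply locally_C1_analytic. intros z0 Hz0. destruct (Ceq_dec z0 0) as [->|N].
    + left. destruct (Hf 0 in_disk_0) as (a & r & Hr & Ha).
      assert (Ha' : forall z, Cmod z < Rmin r 1 -> is_pseries (K := C_AbsRing) (V := C_NormedModule) a z (f z)).
      { intros z Hz. pose proof (Rmin_l r 1). pose proof (Rmin_r r 1).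
        assert (E : (z - 0)%C = z) by ring.
        specialize (Ha z). rewrite E in Ha. apply Ha; unfold in_disk; lra. }
      assert (Pr : 0 < Rmin r 1) by (apply Rmin_glb_lt; lra).
      assert (P0 : Cmod 0 < Rmin r 1) by (rewrite Cmod_0; auto).
      exists (fun k => a (S k)), (Rmin r 1). split; auto.
      intros z. replace (z - 0)%C with z by ring. intros Hz.
      destruct (Ceq_dec z 0) as [->|Nz].
      * destruct (pseries_C_derive a f _ Ha' 0 P0) as [_ D]. apply pseries_at_0 in D.
        unfold deriv_coef in D. rewrite D. simpl INR. rewrite Cmult_1_l. apply (pseries_0 (fun k => a (S k))).
      * rewrite (pseries_at_0 a (f 0)) by (apply Ha'; auto). apply pseries_shift; auto.
    + right. exists (fun z => C_derive f z * / z + (f z + - f 0) * (- (1) * / (z * z)))%C.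
      pose proof (proj1 (Cmod_gt_0 z0) N) as P0.
      exists (Rmin (Cmod z0 / 2) (1 - Cmod z0)). unfold in_disk in Hz0.
      split; [apply Rmin_glb_lt; lra|]. intros z Hz.
      pose proof (Rmin_l (Cmod z0 / 2) (1 - Cmod z0)). pose proof (Rmin_r (Cmod z0 / 2) (1 - Cmod z0)).
      assert (Dz : in_disk z) by (apply (in_disk_near z0); unfold in_disk; lra).
      assert (Pz : 0 < Cmod z).
      { pose proof (Cmod_sub_ge z0 z). rewrite Cmod_sub_sym in Hz. lra. }
      assert (Nz : z <> 0) by (apply Cmod_gt_0; auto).
      split.
      * apply (has_deriv_ext_loc _ (fun z => (f z + - f 0) * / z)%C _ _ _ (Cmod z)); auto.
        -- intros s Hs. destruct (Ceq_dec s 0) as [->|]; [|reflexivity].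
           exfalso. replace (0 - z)%C with (- z)%C in Hs by ring. rewrite Cmod_opp in Hs. lra.
        -- eapply has_deriv_eq.
           ++ apply has_deriv_mult.
              ** apply has_deriv_plus; [apply analytic_cderiv; auto|apply has_deriv_const].
              ** apply cderiv_inv; auto.
           ++ cbv beta; ring.
      * apply cont_plus; apply cont_mult.
        -- apply analytic_ccont; auto using analytic_C_derive.
        -- apply cont_inv; auto. apply cont_id.
        -- apply cont_plus; [apply analytic_ccont; auto|apply cont_const].
        -- apply cont_mult; [apply cont_const|]. apply cont_inv; [apply Cmult_neq_0; auto|].
           apply cont_mult; apply cont_id.
  - destruct (Ceq_dec 0 0) as [|N]; [reflexivity|exfalso; apply N; reflexivity].
  - intros z. destruct (Ceq_dec z 0) as [->|N]; [ring|]. field. auto.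
Qed.

Lemma schwarz (h : C -> C) : analytic_on_disk h ->
  (forall z, in_disk z -> Cmod (z * h z) <= 1) -> forall z, in_disk z -> Cmod (h z) <= 1.
Proof.
  intros Hh H z Hz. apply Rnot_lt_le. intros L. unfold in_disk in *.
  assert (I : / Cmod (h z) < 1) by (rewrite <- Rinv_1; apply Rinv_lt_contravar; lra).
  (* Any radius r between m and 1 encloses z and satisfies 1 / r < |h z|, whereas the maximum
     principle on |w| = r gives |h z| <= 1 / r. *)
  set (m := Rmax (Cmod z) (/ Cmod (h z))).
  assert (Hm : m < 1) by (apply Rmax_lub_lt; auto).
  assert (m1 : Cmod z <= m) by apply Rmax_l. assert (m2 : / Cmod (h z) <= m) by apply Rmax_r.
  pose proof (Cmod_ge_0 z). assert (0 < / Cmod (h z)) by (apply Rinv_0_lt_compat; lra).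
  set (r := (1 + m) / 2).
  pose proof (max_modulus h r (/ r) Hh ltac:(unfold r; lra)) as MM.
  assert (K : Cmod (h z) <= / r).
  { apply MM; [|unfold r; lra]. intros w Hw. assert (Cmod w < 1) by (unfold r in Hw; lra).
    specialize (H w H2). rewrite Cmod_mult, Hw in H.
    apply Rmult_le_reg_l with r; [unfold r; lra|]. rewrite Rinv_r; [auto|unfold r; lra]. }
  assert (K2 : / r < / / Cmod (h z)).
  { apply Rinv_lt_contravar; [apply Rmult_lt_0_compat; unfold r; lra|]. unfold r; lra. }
  rewrite Rinv_inv in K2. lra.
Qed.

Lemma mobius_bound (a h : C) : Cmod a <= 1 -> Cmod h <= 1 -> Cmod (h - a) <= Cmod (1 - Cconj a * h).
Proof.
  intros Ha Hh. apply Rsqr_incr_0_var; [|apply Cmod_ge_0]. rewrite !Rsqr_pow2.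
  assert (E : Cmod (1 - Cconj a * h) ^ 2 - Cmod (h - a) ^ 2 = (1 - Cmod a ^ 2) * (1 - Cmod h ^ 2)).
  { rewrite !Cmod2_alt. destruct a as [a1 a2], h as [h1 h2]. unfold Cconj, Re, Im. simpl. ring. }
  assert (Cmod a ^ 2 <= 1) by (pose proof (Cmod_ge_0 a); simpl; nra).
  assert (Cmod h ^ 2 <= 1) by (pose proof (Cmod_ge_0 h); simpl; nra). nra.
Qed.

(** Composing h with the disk automorphism that sends h(0) to 0 gives a function divisible by z; the
    Schwarz lemma bounds its quotient by z, whose value at 0 is h'(0) / (1 - |h(0)|^2). *)
Lemma schwarz_pick_0 (h : C -> C) : analytic_on_disk h ->
  (forall z, in_disk z -> Cmod (h z) <= 1) -> Cmod (C_derive h 0) <= 1 - Cmod (h 0) ^ 2.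
Proof.
  intros Hh Hb. destruct (divided_difference h Hh) as (h2 & Hh2 & E0 & E).
  rewrite <- E0. set (c1 := h 0) in *. set (c2 := h2 0).
  assert (B1 : Cmod c1 <= 1) by (apply Hb, in_disk_0). pose proof (Cmod_ge_0 c1) as B0.
  (* Scaling by [s < 1] keeps the Moebius denominator away from [0] even if |h 0| = 1. *)
  assert (Main : forall s, 0 < s < 1 -> s * Cmod c2 <= 1 - s ^ 2 * Cmod c1 ^ 2).
  { intros s Hs.
    assert (Ds : forall z, in_disk z -> 0 < Cmod (1 - Cconj (RtoC s * c1) * (RtoC s * h z))).
    { intros z Hz. pose proof (Cmod_sub_ge 1 (Cconj (RtoC s * c1) * (RtoC s * h z))) as K.
      rewrite Cmod_1, !Cmod_mult, Cmod_conj, Cmod_mult, Cmod_R, Rabs_pos_eq in K by lra.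
      specialize (Hb z Hz). pose proof (Cmod_ge_0 (h z)).
      assert (s * Cmod c1 <= s) by nra. assert (s * Cmod (h z) <= s) by nra.
      assert (s * Cmod c1 * (s * Cmod (h z)) <= s * s) by (apply Rmult_le_compat; nra). nra. }
    set (k := fun z => (RtoC s * h2 z * / (1 + - (Cconj (RtoC s * c1)) * (RtoC s * h z)))%C).
    assert (Ed : forall z, (1 + - (Cconj (RtoC s * c1)) * (RtoC s * h z))%C = (1 - Cconj (RtoC s * c1) * (RtoC s * h z))%C)
      by (intros; ring).
    assert (Ak : analytic_on_disk k).
    { apply analytic_mult; [apply analytic_mult; auto using analytic_const|].
      apply analytic_inv.
      - apply analytic_plus; [apply analytic_const|]. apply analytic_mult; [apply analytic_const|].
        apply analytic_mult; auto using analytic_const.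
      - intros z Hz. rewrite Ed. apply Cmod_gt_0, Ds, Hz. }
    assert (K0 : Cmod (k 0) <= 1).
    { apply schwarz; [auto| |apply in_disk_0]. intros z Hz.
      replace (z * k z)%C with ((RtoC s * h z - RtoC s * c1) / (1 - Cconj (RtoC s * c1) * (RtoC s * h z)))%C.
      2:{ unfold k. rewrite Ed, (E z). unfold Cdiv. fold c1. ring. }
      specialize (Ds z Hz). rewrite Cmod_div by (apply Cmod_gt_0; auto).
      apply Rle_div_l; auto. rewrite Rmult_1_l. specialize (Hb z Hz). pose proof (Cmod_ge_0 (h z)).
      apply mobius_bound; rewrite Cmod_mult, Cmod_R, Rabs_pos_eq by lra; nra. }
    unfold k in K0. rewrite Ed in K0. fold c1 c2 in K0.
    assert (Ec : (1 - Cconj (RtoC s * c1) * (RtoC s * c1))%C = RtoC (1 - s ^ 2 * Cmod c1 ^ 2)).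
    { rewrite Cmult_comm, <- Cmod2_conj, Cmod_mult, Cmod_R, Rabs_pos_eq by lra.
      rewrite <- RtoC_minus. f_equal. ring. }
    specialize (Ds 0 in_disk_0). fold c1 in Ds. rewrite Ec in K0, Ds.
    assert (Pos : 0 < 1 - s ^ 2 * Cmod c1 ^ 2).
    { assert (Cmod c1 ^ 2 <= 1) by (simpl; nra). assert (s ^ 2 < 1) by (simpl; nra).
      assert (0 <= s ^ 2) by (simpl; nra). nra. }
    rewrite !Cmod_mult, Cmod_inv, !Cmod_R, !Rabs_pos_eq in K0; try lra.
    - apply Rmult_le_compat_r with (r := 1 - s ^ 2 * Cmod c1 ^ 2) in K0; [|lra].
      rewrite Rmult_assoc, Rinv_l in K0; lra.
    - intros X. apply RtoC_inj in X. lra. }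
  apply Rnot_lt_le. intros L.
  pose proof (Cmod_ge_0 c2) as C0. assert (X0 : 0 <= Cmod c1 ^ 2) by (apply pow_le; auto).
  set (d := Cmod c2 - (1 - Cmod c1 ^ 2)).
  (* Letting s tend to 1 in [Main], made explicit: with s = 1 - t, [Main] forces the excess d to be
     at most t (|c2| + 2 |c1|^2), while this t makes that less than d. *)
  set (s := 1 - Rmin (1/2) (d / (2 * (Cmod c2 + 2 * Cmod c1 ^ 2 + 1)))).
  assert (Q : 0 < d / (2 * (Cmod c2 + 2 * Cmod c1 ^ 2 + 1))) by (apply Rdiv_lt_0_compat; unfold d; lra).
  pose proof (Rmin_l (1/2) (d / (2 * (Cmod c2 + 2 * Cmod c1 ^ 2 + 1)))) as M1.
  pose proof (Rmin_r (1/2) (d / (2 * (Cmod c2 + 2 * Cmod c1 ^ 2 + 1)))) as M2.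
  assert (M3 : 0 < Rmin (1/2) (d / (2 * (Cmod c2 + 2 * Cmod c1 ^ 2 + 1)))) by (apply Rmin_glb_lt; lra).
  set (t := Rmin (1/2) (d / (2 * (Cmod c2 + 2 * Cmod c1 ^ 2 + 1)))) in *.
  specialize (Main s ltac:(unfold s; lra)).
  apply Rmult_le_compat_r with (r := 2 * (Cmod c2 + 2 * Cmod c1 ^ 2 + 1)) in M2; [|lra].
  replace (d / (2 * (Cmod c2 + 2 * Cmod c1 ^ 2 + 1)) * (2 * (Cmod c2 + 2 * Cmod c1 ^ 2 + 1))) with d in M2
    by (field; lra).
  set (X := Cmod c1 ^ 2) in *. unfold s, d in *. nra.
Qed.

(** * Univalence of convex functions *)

Lemma Cexp_Ci (t : R) : Cexp (Ci * RtoC t) = (cos t, sin t).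
Proof.
  replace (Ci * RtoC t)%C with ((0, t) : C) by (apply Ceq; unfold Re, Im; simpl; ring).
  unfold Cexp. simpl. rewrite exp_0, !Rmult_1_l. reflexivity.
Qed.

Lemma polar_unit (w : C) : Cmod w = 1 -> exists t, 0 <= t < 2 * PI /\ w = Cexp (Ci * RtoC t).
Proof.
  intros Hw. assert (E : Re w ^ 2 + Im w ^ 2 = 1) by (rewrite <- Cmod2_alt, Hw; ring).
  pose proof (re_le_Cmod w) as B. rewrite Hw in B. apply Rabs_le_between in B.
  pose proof (acos_bound (Re w)) as A. pose proof PI_RGT_0 as P.
  assert (S2 : sin (acos (Re w)) = Rabs (Im w)).
  { rewrite sin_acos by lra. rewrite <- sqrt_Rsqr_abs. f_equal. unfold Rsqr. lra. }
  destruct (Rle_lt_dec 0 (Im w)) as [I|I].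
  - exists (acos (Re w)). split; [lra|]. rewrite Cexp_Ci.
    rewrite cos_acos, S2, Rabs_pos_eq by lra. destruct w; reflexivity.
  - exists (2 * PI - acos (Re w)).
    assert (acos (Re w) <> 0).
    { intros Z. rewrite Z, sin_0 in S2. symmetry in S2. apply Rabs_eq_0 in S2. lra. }
    split; [lra|]. rewrite Cexp_Ci.
    replace (2 * PI - acos (Re w)) with (- acos (Re w) + 2 * PI) by ring.
    rewrite cos_plus, sin_plus, cos_2PI, sin_2PI, cos_neg, sin_neg, cos_acos, S2, Rabs_left by lra.
    apply Ceq; simpl; ring.
Qed.

Section Convex.
Variables f F : C -> C.
Hypothesis F_analytic : analytic_on_disk F.
Hypothesis f_deriv : forall z, in_disk z -> cderiv f z (Cexp (F z)).
Hypothesis convexity : forall z, in_disk z -> 0 < Re (1 + z * C_derive F z).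

(* The height of f(z) below the tangent of the curve f(|z| = |z0|) at f(z0). *)
Definition support_height (z0 z : C) : R := Re (Cconj (z0 * Cexp (F z0)) * (f z0 - f z)).

(* Along the circle the tangent direction of the image has argument psi + const, where psi
   increases from 0 to 2 pi, and the height has a derivative of the sign of sin psi. *)
Lemma support_height_pos (z0 : C) (t : R) : in_disk z0 -> z0 <> 0 -> 0 < t < 2 * PI ->
  0 < support_height z0 (z0 * Cexp (Ci * RtoC t)).
Proof.
  intros Hz0 Nz0 Ht.
  set (l := fun s : R => (z0 * Cexp (Ci * RtoC s))%C).
  assert (Hl : forall s, in_disk (l s)).
  { intros s. unfold in_disk, l in *. rewrite Cmod_mult.
    replace (Ci * RtoC s)%C with ((0, s) : C) by (apply Ceq; unfold Re, Im; simpl; ring).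
    rewrite Cmod_Cexp_Im. lra. }
  assert (Dl : forall s, rderiv l s (Ci * l s)%C).
  { intros s. eapply has_deriv_eq.
    - apply has_deriv_mult; [apply has_deriv_const|].
      apply (has_deriv_comp RtoC Cexp); [apply cderiv_Cexp|].
      apply has_deriv_mult; [apply has_deriv_const|apply has_deriv_id].
    - unfold l. cbv beta. ring. }
  set (psi := fun s : R => Im (Ci * RtoC s + (F (l s) - F z0))).
  assert (Dpsi : forall s, is_derive psi s (Re (1 + l s * C_derive F (l s)))).
  { intros s. replace (Re (1 + l s * C_derive F (l s))) with
      (Im (Ci + (C_derive F (l s) * (Ci * l s) + 0))) by (unfold Re, Im; simpl; ring).
    apply (rderiv_Im (fun s => Ci * RtoC s + (F (l s) + - F z0))%C).
    apply has_deriv_plus.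
    - eapply has_deriv_eq; [apply has_deriv_mult; [apply has_deriv_const|apply has_deriv_id]|cbv beta; ring].
    - apply has_deriv_plus; [|apply has_deriv_const].
      apply (has_deriv_comp RtoC F); [apply analytic_cderiv; auto|apply Dl]. }
  assert (Mpsi : forall a b, a < b -> psi a < psi b).
  { intros a b Hab. destruct (MVT_cor2 psi (fun s => Re (1 + l s * C_derive F (l s))) a b Hab) as [c [E _]].
    - intros c _. apply is_derive_Reals, Dpsi.
    - pose proof (convexity (l c) (Hl c)).
      assert (0 < Re (1 + l c * C_derive F (l c)) * (b - a)) by (apply Rmult_lt_0_compat; lra). lra. }
  assert (l0 : l 0 = z0).
  { unfold l. rewrite Cexp_Ci, cos_0, sin_0. change ((1, 0) : C) with (RtoC 1). ring. }
  assert (l2 : l (2 * PI) = z0).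
  { unfold l. rewrite Cexp_Ci, cos_2PI, sin_2PI. change ((1, 0) : C) with (RtoC 1). ring. }
  assert (psi0 : psi 0 = 0) by (unfold psi; rewrite l0; unfold Im; simpl; ring).
  assert (psi2 : psi (2 * PI) = 2 * PI) by (unfold psi; rewrite l2; unfold Im; simpl; ring).
  set (h := fun s : R => support_height z0 (l s)).
  (* The product of the speeds of the image curve at z0 and at [l s], where |l s| = |z0|; it is the
     positive factor in front of sin psi. *)
  set (c := fun s : R => Cmod z0 ^ 2 * (exp (Re (F z0)) * exp (Re (F (l s))))).
  assert (c0 : forall s, 0 < c s).
  { intros s. apply Rmult_lt_0_compat; [apply pow_lt, Cmod_gt_0, Nz0|].
    apply Rmult_lt_0_compat; apply exp_pos. }
  assert (Dh : forall s, is_derive h s (c s * sin (psi s))).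
  { intros s.
    replace (c s * sin (psi s)) with
      (Re (0 * (f z0 + - (1) * f (l s)) + Cconj (z0 * Cexp (F z0)) * (0 + (0 * f (l s) + - (1) * (Cexp (F (l s)) * (Ci * l s)))))).
    - unfold h, support_height.
      apply (is_derive_ext (fun s => Re (Cconj (z0 * Cexp (F z0)) * (f z0 + - (1) * f (l s))))).
      { intros x. f_equal. ring. }
      apply (rderiv_Re (fun s => Cconj (z0 * Cexp (F z0)) * (f z0 + - (1) * f (l s)))%C).
      apply (has_deriv_mult RtoC (fun _ => Cconj (z0 * Cexp (F z0))) (fun s => f z0 + - (1) * f (l s))%C); [apply has_deriv_const|].
      apply has_deriv_plus; [apply has_deriv_const|].
      apply (has_deriv_mult RtoC (fun _ => - (1))%C (fun s => f (l s))); [apply has_deriv_const|].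
      apply (has_deriv_comp RtoC f); [apply f_deriv, Hl|apply Dl].
    - unfold c, psi. rewrite Cmod2_alt.
      replace (Im (Ci * RtoC s + (F (l s) - F z0))) with (s + Im (F (l s)) - Im (F z0)) by (unfold Im; simpl; ring).
      generalize (F (l s)) (f (l s)) (F z0) (f z0). intros P P' Q Q'. unfold l. rewrite Cexp_Ci.
      rewrite sin_minus, sin_plus, cos_plus. unfold Cexp, Re, Im. simpl. ring. }
  assert (h0 : h 0 = 0) by (unfold h, support_height; rewrite l0; unfold Re; simpl; ring).
  assert (h2 : h (2 * PI) = 0) by (unfold h, support_height; rewrite l2; unfold Re; simpl; ring).
  (* The height vanishes at both ends. It increases as long as psi < pi and decreases afterwards, so
     it is compared with the end lying on the same side of the turning point as t. *)
  change (0 < h t). destruct (Rle_lt_dec (psi t) PI) as [Hp|Hp].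
  - destruct (MVT_cor2 h (fun s => c s * sin (psi s)) 0 t) as [x [E Hx]]; [lra| |].
    + intros x _. apply is_derive_Reals, Dh.
    + pose proof (Mpsi 0 x ltac:(lra)). pose proof (Mpsi x t ltac:(lra)).
      assert (0 < sin (psi x)) by (apply sin_gt_0; lra).
      assert (0 < c x * sin (psi x) * (t - 0)) by (apply Rmult_lt_0_compat; [apply Rmult_lt_0_compat; [apply c0|lra]|lra]). lra.
  - destruct (MVT_cor2 h (fun s => c s * sin (psi s)) t (2 * PI)) as [x [E Hx]]; [lra| |].
    + intros x _. apply is_derive_Reals, Dh.
    + pose proof (Mpsi t x ltac:(lra)). pose proof (Mpsi x (2 * PI) ltac:(lra)).
      assert (sin (psi x) < 0) by (apply sin_lt_0; lra).
      assert (0 < c x * - sin (psi x) * (2 * PI - t)) by (apply Rmult_lt_0_compat; [apply Rmult_lt_0_compat; [apply c0|lra]|lra]). lra.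
Qed.

Lemma support_height_circle (z0 z : C) : in_disk z0 -> Cmod z = Cmod z0 -> z <> z0 ->
  0 < support_height z0 z.
Proof.
  intros Hz0 Hz N.
  assert (Nz0 : z0 <> 0).
  { intros ->. rewrite Cmod_0 in Hz. apply Cmod_eq_0 in Hz. auto. }
  assert (Q : Cmod (z / z0) = 1).
  { rewrite Cmod_div, Hz by auto. field. apply Rgt_not_eq, Cmod_gt_0, Nz0. }
  destruct (polar_unit _ Q) as [t [Ht E]].
  assert (Ez : z = (z0 * Cexp (Ci * RtoC t))%C) by (rewrite <- E; field; auto).
  rewrite Ez. apply support_height_pos; auto. split; [|apply Ht].
  destruct (Rle_lt_or_eq_dec 0 t) as [|<-]; [lra|auto|].
  exfalso. apply N. rewrite Ez, Cexp_Ci, cos_0, sin_0. change ((1, 0) : C) with (RtoC 1). ring.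
Qed.

(* f' has no zero, so Re (conj(v) f) has no critical point inside the disk. *)
Lemma linear_max_on_circle (v m : C) (r : R) : v <> 0 -> r < 1 -> Cmod m <= r ->
  (forall z, Cmod z <= r -> Re (Cconj v * f z) <= Re (Cconj v * f m)) -> Cmod m = r.
Proof.
  intros Nv Hr Hm Hmax. destruct (Rle_lt_or_eq_dec _ _ Hm) as [L|]; auto. exfalso.
  set (D := (Cconj v * Cexp (F m))%C).
  assert (ND : D <> 0).
  { apply Cmult_neq_0; [|apply Cexp_neq_0]. intros E. apply Nv.
    rewrite <- (Cconj_conj v), E. apply Ceq; simpl; ring. }
  (* In the direction conj(D) the derivative at m is |D|^2 > 0, which a maximum forbids. *)
  set (h := Cconj D). pose proof (Cmod_ge_0 h) as h0.
  assert (Z : Re (D * h) = 0).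
  { apply (fermat_max (fun t => Re (Cconj v * f (m + RtoC t * h)%C)) _ ((r - Cmod m) / (Cmod h + 1))).
    - apply Rdiv_lt_0_compat; lra.
    - replace (D * h)%C with (0 * f (m + RtoC 0 * h) + Cconj v * (Cexp (F (m + RtoC 0 * h)) * h))%C.
      2:{ replace (m + RtoC 0 * h)%C with m by ring. unfold D. ring. }
      apply (rderiv_Re (fun t => Cconj v * f (m + RtoC t * h))%C).
      apply (has_deriv_mult RtoC (fun _ => Cconj v) (fun t => f (m + RtoC t * h)%C)); [apply has_deriv_const|].
      apply (has_deriv_comp RtoC f); [|apply rderiv_line].
      apply f_deriv. replace (m + RtoC 0 * h)%C with m by ring. unfold in_disk; lra.
    - intros t Ht. replace (m + RtoC 0 * h)%C with m by ring. apply Hmax.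
      eapply Rle_trans; [apply Cmod_triangle|]. rewrite Cmod_mult, Cmod_R.
      assert (Rabs t * (Cmod h + 1) < r - Cmod m) by (apply Rlt_div_r; [lra|exact Ht]).
      pose proof (Rabs_pos t). nra. }
  unfold h in Z. rewrite <- Cmod2_conj, re_RtoC in Z.
  pose proof (pow_lt _ 2 (proj1 (Cmod_gt_0 D) ND)). lra.
Qed.

(** On the closed disk |z| <= |z1| the linear functional normal to the tangent at f(z1) is maximal
    at z1. If f(z2) = f(z1) with |z2| <= |z1|, it is maximal at z2 too, which forces |z2| = |z1|;
    strict support on that circle then gives z2 = z1. *)
Lemma convex_univalent : univalent_on_disk f.
Proof.
  assert (Main : forall z1 z2, in_disk z1 -> Cmod z2 <= Cmod z1 -> f z1 = f z2 -> z1 = z2).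
  { intros z1 z2 H1 H21 E. destruct (Ceq_dec z2 z1) as [|N]; auto. exfalso.
    assert (Nz1 : z1 <> 0).
    { intros ->. apply N. apply Cmod_eq_0. pose proof (Cmod_ge_0 z2). rewrite Cmod_0 in H21. lra. }
    set (v := (z1 * Cexp (F z1))%C).
    assert (Nv : v <> 0) by (apply Cmult_neq_0; auto using Cexp_neq_0).
    assert (SH : forall z, support_height z1 z = Re (Cconj v * f z1) - Re (Cconj v * f z)).
    { intros z. unfold support_height. fold v. unfold Re. simpl. ring. }
    destruct (closed_disk_max (Cmod z1) (fun z => Re (Cconj v * f z))) as (m & Hm & Hmax); [apply Cmod_ge_0| |].
    { intros z Hz. apply cont_RtoC_Re. apply cont_mult; [apply cont_const|].
      eapply has_deriv_cont, f_deriv. unfold in_disk in *. lra. }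
    assert (K1 : Re (Cconj v * f m) <= Re (Cconj v * f z1)).
    { pose proof (linear_max_on_circle v m (Cmod z1) Nv H1 Hm Hmax) as Em.
      destruct (Ceq_dec m z1) as [->|Nm]; [lra|].
      pose proof (support_height_circle z1 m H1 Em Nm) as P. rewrite SH in P. lra. }
    assert (E2 : Cmod z2 = Cmod z1).
    { apply (linear_max_on_circle v z2); auto. intros z Hz. rewrite <- E.
      eapply Rle_trans; [apply Hmax, Hz|exact K1]. }
    pose proof (support_height_circle z1 z2 H1 E2 N) as P. rewrite SH, <- E in P. lra. }
  intros z1 z2 H1 H2 E. destruct (Rle_lt_dec (Cmod z2) (Cmod z1)).
  - apply Main; auto.
  - symmetry. apply Main; auto. lra.
Qed.

End Convex.

(** * Coefficients *)

Lemma toeplitz_3_1 (f : C -> C) : taylor_coef f 1 = 1 ->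
  let a2 := taylor_coef f 2 in let a3 := taylor_coef f 3 in
  toeplitz_det 3 1 f = (1 - 2 * (a2 * a2) - a3 * (a3 - 2 * (a2 * a2)))%C.
Proof.
  intros H a2 a3. unfold toeplitz_det. cbn [det].
  do 3 (rewrite ?sum_Sn, ?sum_O; cbn [Nat.ltb Nat.leb Nat.add Nat.sub Cpow]).
  rewrite !H. fold a2 a3. change (@plus C_AbelianMonoid) with Cplus. ring.
Qed.

Lemma taylor_coef_1 (f : C -> C) : taylor_coef f 1 = C_derive f 0.
Proof. unfold taylor_coef. simpl. field. Qed.

Lemma taylor_coef_2 (f : C -> C) : taylor_coef f 2 = (C_derive (C_derive f) 0 / 2)%C.
Proof. unfold taylor_coef. replace (INR (fact 2)) with 2 by (simpl; ring). reflexivity. Qed.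

Lemma taylor_coef_3 (f : C -> C) : taylor_coef f 3 = (C_derive (C_derive (C_derive f)) 0 / 6)%C.
Proof. unfold taylor_coef. replace (INR (fact 3)) with 6 by (simpl; ring). reflexivity. Qed.

Lemma near_0_in_disk (z : C) e : Cmod (z - 0) < Rmin e 1 -> Cmod (z - 0) < e /\ in_disk z.
Proof.
  intros H. pose proof (Rmin_l e 1). pose proof (Rmin_r e 1). unfold in_disk.
  replace (Cmod z) with (Cmod (z - 0)) by (f_equal; ring). lra.
Qed.

Section Coefficients.
Variables phi f w : C -> C.
Hypothesis phi_analytic : analytic_on_disk phi.
Hypothesis f_analytic : analytic_on_disk f.
Hypothesis w_analytic : analytic_on_disk w.
Hypothesis w_disk : forall z, in_disk z -> in_disk (w z).
Hypothesis w_0 : w 0 = 0.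
Hypothesis phi_0 : phi 0 = 1.
Hypothesis f'_0 : C_derive f 0 = 1.
Hypothesis f_eq : forall z, in_disk z ->
  (1 + z * C_derive_n f 2 z / C_derive f z)%C = phi (w z).

Notation f1 := (C_derive f).
Notation f2 := (C_derive f1).
Notation f3 := (C_derive f2).
Notation p1 := (C_derive phi).
Notation p2 := (C_derive p1).
Notation w1 := (C_derive w).
Notation w2 := (C_derive w1).

(** The equation z f'' = (phi(w) - 1) f' is differentiated once near 0 and a second time at 0, which
    avoids any manipulation of coefficient sequences. *)
Lemma subordination_second_order :
  f2 0 = (p1 0 * w1 0)%C /\
  (2 * f3 0)%C = (p2 0 * (w1 0 * w1 0) + p1 0 * w2 0 + 2 * (p1 0 * w1 0 * f2 0))%C.
Proof.
  assert (A1 : analytic_on_disk f1) by auto using analytic_C_derive.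
  assert (A2 : analytic_on_disk f2) by auto using analytic_C_derive.
  assert (A3 : analytic_on_disk f3) by auto using analytic_C_derive.
  assert (Ap : analytic_on_disk p1) by auto using analytic_C_derive.
  assert (Aw : analytic_on_disk w1) by auto using analytic_C_derive.
  (* Near 0 one has |f' - 1| < 1, so f' is nonzero there and the denominator can be cleared. *)
  destruct (analytic_ccont f1 0 A1 in_disk_0 1 Rlt_0_1) as [e [He Ne]].
  set (d := Rmin e 1). assert (Hd : 0 < d) by (apply Rmin_glb_lt; lra).
  assert (E0 : forall z, Cmod (z - 0) < d -> (z * f2 z)%C = ((phi (w z) + - (1)) * f1 z)%C).
  { intros z Hz. destruct (near_0_in_disk z e Hz) as [Hz1 Hz2].
    assert (N : f1 z <> 0).
    { intros N. specialize (Ne z Hz1). rewrite N, f'_0 in Ne.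
      replace (0 - 1)%C with (- (1))%C in Ne by ring. rewrite Cmod_m1 in Ne. lra. }
    rewrite <- f_eq by auto. simpl C_derive_n. change (C_derive_n f 2 z) with (f2 z). field. auto. }
  assert (E1 : forall z, Cmod (z - 0) < d -> (f2 z + z * f3 z)%C =
    (p1 (w z) * w1 z * f1 z + (phi (w z) + - (1)) * f2 z)%C).
  { intros z Hz. destruct (near_0_in_disk z e Hz) as [Hz1 Hz2].
    apply (cderiv_unique (fun z => z * f2 z)%C z).
    - eapply has_deriv_eq; [apply has_deriv_mult; [apply has_deriv_id|apply analytic_cderiv; auto]|]. cbv beta; ring.
    - apply (has_deriv_ext_loc _ (fun z => (phi (w z) + - (1)) * f1 z)%C _ _ _ (d - Cmod (z - 0))); [lra| |].
      + intros s Hs. symmetry. apply E0.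
        replace (s - 0)%C with ((s - z) + (z - 0))%C by ring.
        pose proof (Cmod_triangle (s - z) (z - 0)). lra.
      + eapply has_deriv_eq.
        * apply has_deriv_mult; [|apply analytic_cderiv; auto].
          apply has_deriv_plus; [|apply has_deriv_const].
          apply (has_deriv_comp _ phi); apply analytic_cderiv; auto.
        * cbv beta; ring. }
  assert (Z0 : Cmod (0 - 0) < d) by (replace (0 - 0)%C with (RtoC 0) by ring; rewrite Cmod_0; auto).
  assert (F2 : f2 0 = (p1 0 * w1 0)%C).
  { pose proof (E1 0 Z0) as H. rewrite w_0, phi_0, f'_0 in H.
    transitivity (f2 0 + 0 * f3 0)%C; [ring|]. rewrite H. ring. }
  split; auto.
  assert (H : (f3 0 + (f3 0 + 0 * C_derive f3 0))%C =
    ((p2 (w 0) * w1 0 * w1 0 + p1 (w 0) * w2 0) * f1 0 + p1 (w 0) * w1 0 * f2 0 +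
     (p1 (w 0) * w1 0 * f2 0 + (phi (w 0) + - (1)) * f3 0))%C).
  { apply (cderiv_unique (fun z => f2 z + z * f3 z)%C 0).
    - eapply has_deriv_eq.
      + apply has_deriv_plus; [apply analytic_cderiv; auto using in_disk_0|].
        apply has_deriv_mult; [apply has_deriv_id|apply analytic_cderiv; auto using in_disk_0].
      + cbv beta; ring.
    - apply (has_deriv_ext_loc _ (fun z => p1 (w z) * w1 z * f1 z + (phi (w z) + - (1)) * f2 z)%C _ _ _ d); auto.
      { intros s Hs. symmetry. apply E1, Hs. }
      eapply has_deriv_eq.
      + apply has_deriv_plus; apply has_deriv_mult.
        * apply has_deriv_mult; [apply (has_deriv_comp _ p1)|]; apply analytic_cderiv; auto using in_disk_0.
        * apply analytic_cderiv; auto using in_disk_0.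
        * apply has_deriv_plus; [|apply has_deriv_const].
          apply (has_deriv_comp _ phi); apply analytic_cderiv; auto using in_disk_0.
        * apply analytic_cderiv; auto using in_disk_0.
      + cbv beta; ring. }
  rewrite w_0, phi_0, f'_0 in H.
  transitivity (f3 0 + (f3 0 + 0 * C_derive f3 0))%C; [ring|]. rewrite H. ring.
Qed.

Variables B1 B2 : R.
Hypothesis HB1 : taylor_coef phi 1 = RtoC B1.
Hypothesis HB2 : taylor_coef phi 2 = RtoC B2.

Lemma convex_coefficients (c1 c2 : C) : w1 0 = c1 -> w2 0 = (2 * c2)%C ->
  taylor_coef f 2 = (B1 * c1 / 2)%C /\
  taylor_coef f 3 = ((B1 * c2 + (B2 + B1 ^ 2)%R * (c1 * c1)) / 6)%C.
Proof.
  intros Hc1 Hc2. destruct subordination_second_order as [H1 H2].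
  rewrite taylor_coef_1 in HB1. rewrite taylor_coef_2 in HB2.
  assert (P2 : p2 0 = (2 * B2)%C).
  { rewrite <- HB2. field. }
  rewrite Hc1, HB1 in H1. rewrite Hc1, Hc2, HB1, P2, H1 in H2.
  rewrite taylor_coef_2, taylor_coef_3, H1. split; auto.
  replace (f3 0) with (2 * f3 0 / 2)%C by field.
  rewrite H2, RtoC_plus, RtoC_pow. field.
Qed.

End Coefficients.

(** Dividing w by z gives a function h with |h| <= 1 on the disk, and c1 = h(0), c2 = h'(0).
    Equality |h| = 1 does occur for rotations, which is why the Schwarz-Pick step assumes only the
    closed bound. *)
Lemma schwarz_coefficients (w : C -> C) : analytic_on_disk w ->
  (forall z, in_disk z -> in_disk (w z)) -> w 0 = 0 ->
  exists c1 c2, C_derive w 0 = c1 /\ C_derive (C_derive w) 0 = (2 * c2)%C /\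
    Cmod c1 <= 1 /\ Cmod c2 <= 1 - Cmod c1 ^ 2.
Proof.
  intros Hw Hd H0. destruct (divided_difference w Hw) as (h & Hh & Eh & E).
  assert (Bh : forall z, in_disk z -> Cmod (h z) <= 1).
  { apply schwarz; auto. intros z Hz. left. specialize (Hd z Hz). rewrite (E z), H0 in Hd.
    unfold in_disk in Hd. rewrite Cplus_0_l in Hd. exact Hd. }
  exists (h 0), (C_derive h 0). split; [auto|]. split; [|split].
  - assert (W1 : forall z, in_disk z -> cderiv w z (h z + z * C_derive h z)%C).
    { intros z Hz. apply (has_deriv_ext_loc _ (fun z => w 0 + z * h z)%C _ _ _ 1); [lra|intros; symmetry; auto|].
      eapply has_deriv_eq.
      - apply has_deriv_plus; [apply has_deriv_const|].
        apply has_deriv_mult; [apply has_deriv_id|apply analytic_cderiv; auto].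
      - cbv beta; ring. }
    apply cderiv_C_derive.
    apply (has_deriv_ext_loc _ (fun z => h z + z * C_derive h z)%C _ _ _ 1); [lra| |].
    { intros s Hs. symmetry. apply cderiv_C_derive, W1. unfold in_disk.
      replace s with (s - 0)%C by ring. auto. }
    eapply has_deriv_eq.
    + apply has_deriv_plus; [apply analytic_cderiv; auto using in_disk_0|].
      apply has_deriv_mult; [apply has_deriv_id|apply analytic_cderiv; auto using analytic_C_derive, in_disk_0].
    + cbv beta; ring.
  - apply Bh, in_disk_0.
  - apply schwarz_pick_0; auto.
Qed.

(** * The extremal function and the sharp bound *)

Lemma in_disk_mult_Ci (z : C) : in_disk z -> in_disk (Ci * z).
Proof. unfold in_disk. rewrite Cmod_mult, Cmod_Ci. lra. Qed.

(** The differential equation is solved by two successive primitives, of g = (phi(i z) - 1) / z and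
    of exp F. Univalence needs Re (1 + z F') > 0, which is the positivity of Re phi at i z. *)
Lemma class_K_extremal (phi : C -> C) : analytic_on_disk phi ->
  (forall z, in_disk z -> 0 < Re (phi z)) -> phi 0 = 1 ->
  exists f, class_S f /\ forall z, in_disk z ->
    (1 + z * C_derive_n f 2 z / C_derive f z)%C = phi (Ci * z)%C.
Proof.
  intros Hphi Hre H0.
  assert (Hpsi : analytic_on_disk (fun z => phi (Ci * z)%C)).
  { apply analytic_comp; auto using in_disk_mult_Ci. apply analytic_mult; [apply analytic_const|apply analytic_id]. }
  destruct (divided_difference _ Hpsi) as (g & Hg & _ & Eg).
  replace (Ci * 0)%C with (RtoC 0) in Eg by ring. rewrite H0 in Eg.
  destruct (primitive_on_disk g Hg) as (F & F0 & DF).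
  assert (AF : analytic_on_disk F).
  { apply (C1_analytic _ g); auto. intros; apply analytic_ccont; auto. }
  assert (DE : forall z, in_disk z -> cderiv (fun z => Cexp (F z)) z (Cexp (F z) * g z)%C).
  { intros z Hz. apply (has_deriv_comp _ Cexp); [apply cderiv_Cexp|auto]. }
  assert (CE : forall z, in_disk z -> ccont (fun z => Cexp (F z)) z).
  { intros z Hz. eapply has_deriv_cont, DE, Hz. }
  assert (AE : analytic_on_disk (fun z => Cexp (F z))).
  { apply (C1_analytic _ (fun z => Cexp (F z) * g z)%C); auto.
    intros z Hz. apply cont_mult; auto. apply analytic_ccont; auto. }
  destruct (primitive_on_disk _ AE) as (f & f0 & Df).
  assert (f1 : forall z, in_disk z -> C_derive f z = Cexp (F z)).
  { intros z Hz. apply cderiv_C_derive; auto. }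
  assert (f2 : forall z, in_disk z -> C_derive (C_derive f) z = (Cexp (F z) * g z)%C).
  { intros z Hz. apply cderiv_C_derive.
    apply (has_deriv_ext_loc _ (fun z => Cexp (F z)) _ _ _ (1 - Cmod z)); auto.
    - unfold in_disk in Hz. lra.
    - intros s Hs. symmetry. apply f1. apply (in_disk_near z); auto. }
  exists f. split.
  - split.
    + split; [|split].
      * apply (C1_analytic _ (fun z => Cexp (F z))); auto.
      * unfold taylor_coef. simpl. rewrite f0. field.
      * rewrite taylor_coef_1, f1, F0 by apply in_disk_0. apply Cexp_0.
    + apply (convex_univalent f F); auto. intros z Hz.
      rewrite (cderiv_C_derive F z (g z)) by auto. rewrite <- Eg. apply Hre, in_disk_mult_Ci, Hz.
  - intros z Hz. change (C_derive_n f 2 z) with (C_derive (C_derive f) z).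
    rewrite f2, f1, Eg by auto. field. apply Cexp_neq_0.
Qed.

Theorem theorem2p4
  (phi : C -> C)
  (phi_analytic : analytic_on_disk phi)
  (phi_univalent : univalent_on_disk phi)
  (phi_Re_pos : forall z : C, in_disk z -> 0 < Re (phi z))
  (phi_0 : phi 0 = RtoC 1)
  (phi'_0 : Im (C_derive phi 0) = 0 /\ 0 < Re (C_derive phi 0))
  (phi''_0 : Im (C_derive_n phi 2 0) = 0)
  (B1 B2 : R)
  (HB1 : taylor_coef phi 1 = RtoC B1)
  (HB2 : taylor_coef phi 2 = RtoC B2)
  (B1_pos : 0 < B1)
  (B2_ge : B1 - B1 ^ 2 <= B2)
  (B2_le : B2 <= 2 * B1 ^ 2 - B1) :
  let bound := 1 + / 2 * B1 ^ 2 + / 36 * ((B1 ^ 2 + B2) * (2 * B1 ^ 2 - B2)) in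
  (forall f : C -> C, class_K phi f -> Cmod (toeplitz_det 3 1 f) <= bound) /\
  (exists f : C -> C, class_K phi f /\ Cmod (toeplitz_det 3 1 f) = bound).
Proof.
  intros bound. split.
  - intros f [[[Hf [_ T1]] _] (w & Hw & Hwd & Hw0 & Heq)].
    assert (f'0 : C_derive f 0 = 1) by (rewrite <- taylor_coef_1; exact T1).
    destruct (schwarz_coefficients w Hw Hwd Hw0) as (c1 & c2 & W1 & W2 & C1 & C2).
    destruct (convex_coefficients phi f w phi_analytic Hf Hw Hwd Hw0 phi_0 f'0 Heq B1 B2 HB1 HB2 c1 c2 W1 W2)
      as [A2 A3].
    rewrite (toeplitz_3_1 f T1), A2, A3.
    set (x := Cmod c1 ^ 2).
    assert (X : 0 <= x <= 1).
    { unfold x. pose proof (Cmod_ge_0 c1). split; [apply pow_le; auto|]. simpl. nra. }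
    fold x in C2.
    (* The bound B1 (1 - x) + |m| x is affine in x = |c1|^2 and nondecreasing when |m| >= B1, hence
       at most its value |m| at x = 1. *)
    assert (Lin : forall m : R, B1 <= Rabs m ->
      Cmod ((B1 * c2 + m * (c1 * c1)) / 6) <= Rabs m / 6).
    { intros m Hm. rewrite Cmod_div by (intros K; apply RtoC_inj in K; lra).
      rewrite Cmod_R, (Rabs_pos_eq 6) by lra. apply Rmult_le_compat_r; [lra|].
      eapply Rle_trans; [apply Cmod_triangle|]. rewrite !Cmod_mult, !Cmod_R, (Rabs_pos_eq B1) by lra.
      replace (Cmod c1 * Cmod c1) with x by (unfold x; ring).
      assert (B1 * Cmod c2 <= B1 * (1 - x)) by (apply Rmult_le_compat_l; lra). nra. }
    pose proof (Lin (B2 + B1 ^ 2)) as L1. rewrite Rabs_pos_eq in L1 by lra.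
    pose proof (Lin (B2 - 2 * B1 ^ 2)) as L2. rewrite Rabs_left in L2 by lra.
    specialize (L1 ltac:(lra)). specialize (L2 ltac:(lra)).
    set (a2 := (B1 * c1 / 2)%C). set (a3 := ((B1 * c2 + (B2 + B1 ^ 2)%R * (c1 * c1)) / 6)%C) in *.
    replace (a3 - 2 * (a2 * a2))%C with ((B1 * c2 + (B2 - 2 * B1 ^ 2)%R * (c1 * c1)) / 6)%C.
    2:{ unfold a3, a2. rewrite RtoC_minus, RtoC_plus, RtoC_mult, RtoC_pow. field. }
    set (b3 := ((B1 * c2 + (B2 - 2 * B1 ^ 2)%R * (c1 * c1)) / 6)%C) in *.
    assert (La : Cmod (2 * (a2 * a2)) <= / 2 * B1 ^ 2).
    { replace (2 * (a2 * a2))%C with ((/ 2 * B1 ^ 2)%R * (c1 * c1))%C.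
      2:{ unfold a2. rewrite RtoC_mult, RtoC_inv, RtoC_pow by lra. field. }
      rewrite !Cmod_mult, Cmod_R, Rabs_pos_eq by nra.
      replace (Cmod c1 * Cmod c1) with x by (unfold x; ring). nra. }
    assert (Lb : Cmod (a3 * b3) <= (B2 + B1 ^ 2) / 6 * (- (B2 - 2 * B1 ^ 2) / 6)).
    { rewrite Cmod_mult. apply Rmult_le_compat; auto using Cmod_ge_0. }
    eapply Rle_trans; [apply Cmod_sub_le|].
    pose proof (Cmod_sub_le 1 (2 * (a2 * a2))) as K. rewrite Cmod_1 in K. unfold bound. lra.
  - destruct (class_K_extremal phi phi_analytic phi_Re_pos phi_0) as (f & Sf & Heq).
    exists f. destruct Sf as [[Hf [T0 T1]] Uf].
    assert (Aw : analytic_on_disk (fun z => Ci * z)%C)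
      by (apply analytic_mult; [apply analytic_const|apply analytic_id]).
    assert (Dw : forall z, cderiv (fun z => Ci * z)%C z Ci).
    { intros z. eapply has_deriv_eq; [apply has_deriv_mult; [apply has_deriv_const|apply has_deriv_id]|cbv beta; ring]. }
    assert (w0 : (Ci * 0)%C = 0) by ring.
    split.
    { split; [repeat split; auto|]. exists (fun z => Ci * z)%C. auto using in_disk_mult_Ci. }
    assert (W2 : C_derive (C_derive (fun z => Ci * z)%C) 0 = (2 * 0)%C).
    { apply cderiv_C_derive. replace (2 * 0)%C with (RtoC 0) by ring.
      apply (has_deriv_ext_loc _ (fun _ => Ci) _ _ _ 1); [lra| |apply has_deriv_const].
      intros s _. symmetry. apply cderiv_C_derive, Dw. }
    assert (f'0 : C_derive f 0 = 1) by (rewrite <- taylor_coef_1; exact T1).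
    destruct (convex_coefficients phi f (fun z => Ci * z)%C phi_analytic Hf Aw in_disk_mult_Ci w0 phi_0 f'0
      Heq B1 B2 HB1 HB2 Ci 0 (cderiv_C_derive _ _ _ (Dw 0)) W2) as [A2 A3].
    rewrite (toeplitz_3_1 f T1), A2, A3.
    (* With c1 = i and c2 = 0, a3 = - (B1^2 + B2) / 6 and a3 - 2 a2^2 = (2 B1^2 - B2) / 6 have
       opposite signs, so minus their product adds to 1 + B1^2 / 2. *)
    replace (1 - 2 * (B1 * Ci / 2 * (B1 * Ci / 2)) -
      (B1 * 0 + (B2 + B1 ^ 2)%R * (Ci * Ci)) / 6 *
      ((B1 * 0 + (B2 + B1 ^ 2)%R * (Ci * Ci)) / 6 - 2 * (B1 * Ci / 2 * (B1 * Ci / 2))))%C with (RtoC bound).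
    + rewrite Cmod_R. apply Rabs_pos_eq. unfold bound.
      assert (0 <= (B1 ^ 2 + B2) * (2 * B1 ^ 2 - B2)) by (apply Rmult_le_pos; lra).
      assert (0 <= B1 ^ 2) by (apply pow_le; lra). lra.
    + unfold bound.
      replace (B1 * Ci / 2 * (B1 * Ci / 2))%C with (B1 * B1 / 4 * (Ci * Ci))%C by field.
      replace (Ci * Ci)%C with (- (1))%C by (apply Ceq; unfold Re, Im; simpl; ring).
      repeat (rewrite ?RtoC_plus, ?RtoC_minus, ?RtoC_mult, ?RtoC_pow, ?RtoC_inv by lra).
      field.
Qed.
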